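(* Let $W$ be a finite real reflection group with root system $\Phi$, fixed positive system $\Phi^+\subset\Phi$, set of reflections $T$ and Coxeter element $\gamma$, and let $\lambda$ be the natural edge labeling of $\mathrm{NC}_W(\gamma)$. (i) For any total ordering of $T$ and any non-singleton interval $[u,v]$ in $\mathrm{NC}_W(\gamma)$ there is a unique lexicographically smallest maximal chain in $[u,v]$, and this chain is rising with respect to $\lambda$. (ii) If $T$ is totally ordered by a reflection ordering which is compatible with $\gamma$ and $W$ is a Weyl group, then $\lambda$ is an EL-labeling of $\mathrm{NC}_W(\gamma)$.
   Context: $W$ has rank $\ell$ and acts faithfully by orthogonal transformations on an $\ell$-dimensional Euclidean space $V$, generated by orthogonal reflections. $\Phi$ is a $W$-invariant set consisting of one pair $\{\alpha,-\alpha\}$ of nonzero vectors for each reflection in $W$, orthogonal to its reflecting hyperplane; $t_\alpha$ is the reflection in the hyperplane orthogonal to $\alpha$. $\Phi$ is crystallographic, and $W$ is a Weyl group, if $2(\alpha,\beta)/(\alpha,\alpha)\in\mathbb{Z}$ for all $\alpha,\beta\in\Phi$. A Coxeter element of $W$ is the product, in an arbitrary order, of the simple reflections for any choice of simple system for $\Phi$. For $w\in W$, $l_T(w)$ is the smallest $k$ such that $w$ is a product of $k$ elements of $T$; $u\preceq v$ if and only if $l_T(u)+l_T(u^{-1}v)=l_T(v)$; $\mathrm{NC}_W(w)$ is the interval $[1,w]$ in $(W,\preceq)$, graded by $l_T$. Every covering relation $(u,v)$ of $\mathrm{NC}_W(\gamma)$ satisfies $u^{-1}v\in T$; the natural edge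 labeling is $\lambda(u,v)=u^{-1}v$, with label set $T$. Reflection ordering: a total ordering $<$ of $T$ such that whenever $\alpha,\alpha_1,\alpha_2\in\Phi^+$ are distinct and $\alpha$ is a positive linear combination of $\alpha_1,\alpha_2$, either $t_{\alpha_1}<t_\alpha<t_{\alpha_2}$ or $t_{\alpha_2}<t_\alpha<t_{\alpha_1}$. Compatibility: a rank 2 induced subsystem $\Phi'$ of $\Phi$ is the intersection of $\Phi$ with the linear span of two linearly independent roots; it is a root system with positive system $\Phi'\cap\Phi^+$, and is irreducible if and only if $\Phi'\cap\Phi^+$ has at least three roots. A reflection ordering $<$ is compatible with $\gamma$ if for every irreducible rank 2 induced subsystem $\Phi'\subseteq\Phi$: if $\alpha$ and $\beta$ are the simple roots of $\Phi'$ with respect to $\Phi'\cap\Phi^+$ and $t_\alpha t_\beta\in\mathrm{NC}_W(\gamma)$, then $t_\alpha<t_\beta$. Chains and EL-labelings: for a totally ordered label set, the label of an unrefinable chain $x_0<\cdots<x_r$ is $(\lambda(x_0,x_1),\dots,\lambda(x_{r-1},x_r))$; the chain is rising if its entries strictly increase; chains of equal length are compared by the lexicographic order on their labels. An edge labeling of a finite bounded graded poset is an EL-labeling if in every non-singleton interval there is a unique rising maximal chain and this chain is lexicographically smallest among all maximal chains of the interval. *)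

(* Defs.v *)
From HB Require Import structures.
From mathcomp Require Import all_boot all_order all_algebra all_fingroup all_character.
From mathcomp Require Import boolp classical_sets reals.

Set Implicit Arguments.
Unset Strict Implicit.
Unset Printing Implicit Defensive.

Import Order.TTheory GRing.Theory Num.Theory.
Local Open Scope ring_scope.

(* The Euclidean space is 'cV[R]_l with the standard inner product; a matrix
   acts on it by left multiplication, so that products in the group are
   composed as functions, (w1 w2) v = w1 (w2 v). *)
Definition dotv (R : realType) (l : nat) (u v : 'cV[R]_l) : R :=
  (u^T *m v) 0 0.

(* x |-> x - 2 (a, x) / (a, a) a *)
Definition reflmx (R : realType) (l : nat) (a : 'cV[R]_l) : 'M[R]_l :=
  1%:M - (2 / dotv a a) *: (a *m a^T).

Definition reflections (R : realType) (l : nat) (W : finGroupType)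
    (rW : mx_representation R [set: W] l) : {set W} :=
  [set t | `[< exists2 a : 'cV[R]_l, a != 0 & rW t = reflmx a >]].

Definition reflection_group (R : realType) (l : nat) (W : finGroupType)
    (rW : mx_representation R [set: W] l) : Prop :=
  [/\ mx_faithful rW,
      forall w : W, (rW w)^T *m rW w = 1%:M
    & <<reflections rW>>%g = [set: W]].

Definition root_system (R : realType) (l : nat) (W : finGroupType)
    (rW : mx_representation R [set: W] l) (Phi : set 'cV[R]_l) : Prop :=
  [/\ forall a, Phi a -> a != 0 /\ exists t : W, rW t = reflmx a,
      forall t : W, t \in reflections rW ->
        exists2 a, Phi a & rW t = reflmx a,
      forall a, Phi a -> Phi (- a),
      forall a b, Phi a -> Phi b -> reflmx a = reflmx b -> b = a \/ b = - a
    & forall (w : W) a, Phi a -> Phi (rW w *m a)].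

Definition spanning (R : realType) (l : nat) (Phi : set 'cV[R]_l) : Prop :=
  exists2 X : seq 'cV[R]_l, {in X, forall a, Phi a} & <<X>>%VS = fullv.

Definition crystallographic (R : realType) (l : nat) (Phi : set 'cV[R]_l) :
    Prop :=
  forall a b, Phi a -> Phi b -> 2 * dotv a b / dotv a a \is a Num.int.

(* t_a, as an element of the abstract group; junk value 1 if the reflection
   orthogonal to a is not in the image of rW. *)
Definition root_refl (R : realType) (l : nat) (W : finGroupType)
    (rW : mx_representation R [set: W] l) (a : 'cV[R]_l) : W :=
  odflt 1%g [pick t : W | rW t == reflmx a].

Definition positive_system (R : realType) (l : nat)
    (Phi PhiP : set 'cV[R]_l) : Prop :=
  exists2 r : 'cV[R]_l, forall a, Phi a -> dotv r a != 0
    & forall a, PhiP a <-> Phi a /\ 0 < dotv r a.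

Definition nneg_comb (R : realType) (l : nat) (D : seq 'cV[R]_l)
    (v : 'cV[R]_l) : Prop :=
  exists2 c : 'cV[R]_l -> R, forall a, 0 <= c a
    & v = \sum_(a <- D) c a *: a.

Definition simple_system (R : realType) (l : nat) (Phi : set 'cV[R]_l)
    (D : seq 'cV[R]_l) : Prop :=
  [/\ {in D, forall a, Phi a},
      free D
    & forall a, Phi a -> nneg_comb D a \/ nneg_comb D (- a)].

(* D is an arbitrary list, so its order is the order of the product. *)
Definition coxeter_element (R : realType) (l : nat) (W : finGroupType)
    (rW : mx_representation R [set: W] l) (Phi : set 'cV[R]_l) (g : W) : Prop :=
  exists2 D : seq 'cV[R]_l, simple_system Phi D
    & g = (\prod_(a <- D) root_refl rW a)%g.

(* (T ^+ k)%g is the set of all products of k elements of T; the junk value 0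
   is taken on elements not generated by T. *)
Definition abs_length (W : finGroupType) (T : {set W}) (w : W) : nat :=
  if pselect (exists k, w \in (T ^+ k)%g) is left ex then ex_minn ex else 0%N.

Definition abs_le (W : finGroupType) (T : {set W}) (u v : W) : bool :=
  (abs_length T u + abs_length T (u^-1 * v)%g)%N == abs_length T v.

Definition NC (W : finGroupType) (T : {set W}) (w : W) : {set W} :=
  [set x | abs_le T 1%g x && abs_le T x w].

Definition natural_label (W : finGroupType) (u v : W) : W := (u^-1 * v)%g.

Definition strict_total_order_on (L : finType) (T : {set L}) (lt : rel L) :
    Prop :=
  [/\ {in T, forall x, ~~ lt x x},
      {in T & &, transitive lt}
    & {in T &, forall x y, x != y -> lt x y || lt y x}].

(* A finite poset is a set P with a relation le used only on P. A chain
   u = x_0 < ... < x_r is given by u and c = [:: x_1; ...; x_r]. *)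
Definition finite_poset (X : finType) (le : rel X) (P : {set X}) : Prop :=
  [/\ {in P, reflexive le}, {in P &, antisymmetric le}
    & {in P & &, transitive le}].

Definition covers (X : finType) (le : rel X) (P : {set X}) (x y : X) : bool :=
  [&& x \in P, y \in P, x != y, le x y
    & [forall z in P, le x z && le z y ==> (z == x) || (z == y)]].

Definition maximal_chain (X : finType) (le : rel X) (P : {set X}) (u v : X)
    (c : seq X) : bool :=
  path (covers le P) u c && (last u c == v).

Definition bounded_graded (X : finType) (le : rel X) (P : {set X}) : Prop :=
  exists bot top : X,
    [/\ bot \in P, top \in P, {in P, forall x, le bot x && le x top}
      & forall c c', maximal_chain le P bot top c ->
          maximal_chain le P bot top c' -> size c = size c'].

Definition chain_label (X L : finType) (lab : X -> X -> L) (u : X)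
    (c : seq X) : seq L := pairmap lab u c.

Definition rising (X L : finType) (lt : rel L) (lab : X -> X -> L) (u : X)
    (c : seq X) : bool := sorted lt (chain_label lab u c).

Fixpoint lex_le (L : finType) (lt : rel L) (s t : seq L) : bool :=
  match s, t with
  | [::], _ => true
  | _ :: _, [::] => false
  | x :: s', y :: t' => lt x y || (x == y) && lex_le lt s' t'
  end.

Definition lex_smallest (X L : finType) (le : rel X) (P : {set X}) (lt : rel L)
    (lab : X -> X -> L) (u v : X) (c : seq X) : Prop :=
  maximal_chain le P u v c /\
  forall c', maximal_chain le P u v c' ->
    lex_le lt (chain_label lab u c) (chain_label lab u c').

Definition EL_labeling (X L : finType) (le : rel X) (P : {set X}) (T : {set L})
    (lt : rel L) (lab : X -> X -> L) : Prop :=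
  [/\ finite_poset le P,
      bounded_graded le P,
      forall x y, covers le P x y -> lab x y \in T
    & forall u v, u \in P -> v \in P -> le u v -> u != v ->
        exists2 c, unique (fun c => maximal_chain le P u v c /\
                                    rising lt lab u c) c
          & lex_smallest le P lt lab u v c].

Definition reflection_ordering (R : realType) (l : nat) (W : finGroupType)
    (rW : mx_representation R [set: W] l) (PhiP : set 'cV[R]_l) (lt : rel W) :
    Prop :=
  strict_total_order_on (reflections rW) lt /\
  forall a a1 a2, PhiP a -> PhiP a1 -> PhiP a2 ->
    a != a1 -> a != a2 -> a1 != a2 ->
    (exists c1 c2 : R, [/\ 0 < c1, 0 < c2 & a = c1 *: a1 + c2 *: a2]) ->
    let t := root_refl rW in
    (lt (t a1) (t a) /\ lt (t a) (t a2)) \/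
    (lt (t a2) (t a) /\ lt (t a) (t a1)).

Definition rank2_induced (R : realType) (l : nat)
    (Phi Psi : set 'cV[R]_l) : Prop :=
  exists a b, [/\ Phi a, Phi b, free [:: a; b]
    & forall x, Psi x <-> Phi x /\ x \in <<[:: a; b]>>%VS].

Definition irreducible_roots (R : realType) (l : nat) (Psi : set 'cV[R]_l) :
    Prop :=
  (exists a, Psi a) /\
  ~ exists A B : set 'cV[R]_l,
      [/\ exists a, A a, exists b, B b, forall x, Psi x <-> A x \/ B x
        & forall a b, A a -> B b -> dotv a b = 0].

(* [PhiP] need not be contained in [Psi]: the positive system of [Psi] is
   their intersection. *)
Definition compatible (R : realType) (l : nat) (W : finGroupType)
    (rW : mx_representation R [set: W] l) (Phi PhiP : set 'cV[R]_l) (g : W)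
    (lt : rel W) : Prop :=
  forall Psi, rank2_induced Phi Psi -> irreducible_roots Psi ->
  forall a b, simple_system Psi [:: a; b] -> PhiP a -> PhiP b ->
    (root_refl rW a * root_refl rW b)%g \in NC (reflections rW) g ->
    lt (root_refl rW a) (root_refl rW b).

(* Main.v *)
Require Import Defs.
From mathcomp Require Import all_boot all_order all_algebra all_fingroup all_character.
From mathcomp Require Import boolp classical_sets reals.
From mathcomp Require Import zify ring lra.

(** (i) Hurwitz moves [t0 t1 = t1 (t1 t0 t1)] show that the greedy factorisation
    of [u^-1 v] is rising.

    (ii) Let [E x y = x^T (1 - g)^-1 y].  Since [g] is orthogonal,
    [E x y + E y x = (x,y)], and if [b_1, ..., b_l] are the roots of a reduced
    factorisation of [g] then [E b_j b_i = 0] for [i < j].  Applied to the simple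
    factorisation this shows that [2 E x y] is an integral multiple of [(x,x)] and
    of [(y,y)] for all roots of a crystallographic system; applied to a
    factorisation of [w <= g] it shows that a root in the span of its roots has
    integral coordinates, for the roots as well as for the coroots.  When these
    roots are moreover pairwise obtuse, comparing lengths shows that the
    coordinates of a root all have the same sign, so they form a simple system and
    every reflection ordering has its minimum below [w] at one of them.
    Compatibility with [g] makes the roots of a rising factorisation pairwise
    obtuse, so its first letter is the smallest reflection below [w], which
    determines rising factorisations by induction. *)

(** * Absolute length and noncrossing partitions *)

Section AbsoluteLength.

Set Implicit Arguments.
Unset Strict Implicit.
Unset Printing Implicit Defensive.

Import GroupScope.
Local Open Scope group_scope.

Variables (W : finGroupType) (T : {set W}).

Hypothesis gen_T : <<T>> = [set: W].
Hypothesis conj_T : forall t x : W, t \in T -> t ^ x \in T.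
Hypothesis invol_T : forall t : W, t \in T -> t * t = 1.
Hypothesis T1 : 1 \notin T.

Local Notation len := (abs_length T).
Local Notation prodT ts := (\prod_(t <- ts) t).

Lemma expset_seqP (w : W) (k : nat) :
  w \in (T ^+ k)%g <->
  exists ts : seq W, [/\ all (mem T) ts, size ts = k & prodT ts = w].
Proof.
elim: k w => [|k IHk] w.
  rewrite expg0 inE; split=> [/eqP ->|[ts [_ /size0nil -> <-]]].
    by exists [::]; rewrite big_nil.
  by rewrite big_nil.
rewrite expgS; split=> [/mulsgP[t u Tt /IHk[ts [Tts <- <-]] ->]|].
  by exists (t :: ts); rewrite /= Tt Tts big_cons.
case=> [[|t ts] [//= /andP[Tt Tts] [sz] <-]]; rewrite big_cons mem_mulg //.
by apply/IHk; exists ts.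
Qed.

(** Since [T] generates the finite group [W], every element is a product of elements of [T], without
    inverses, so the default value of [abs_length] never occurs. *)
Lemma abs_length_spec (w : W) :
  w \in (T ^+ len w)%g /\ forall k, w \in (T ^+ k)%g -> (len w <= k)%N.
Proof.
rewrite /abs_length; case: pselect => [ex|[]].
  by case: ex_minnP => k Tk min_k; split=> // j /min_k.
have /gen_prodgP[n [c Tc ->]] : w \in <<T>> by rewrite gen_T inE.
exists n; apply/expset_seqP; exists [seq c i | i <- index_enum 'I_n].
rewrite size_map big_map; split=> //; last first.
  by rewrite [index_enum _]unlock -enumT size_enum_ord.
by apply/allP => _ /mapP[i _ ->]; apply: Tc.
Qed.

Definition reduced (w : W) (ts : seq W) : bool :=
  [&& all (mem T) ts, prodT ts == w & size ts == len w].

Lemma reduced_exists (w : W) : exists ts, reduced w ts.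
Proof.
have [/expset_seqP[ts [Tts sz pw]] _] := abs_length_spec w.
by exists ts; rewrite /reduced Tts pw sz !eqxx.
Qed.

Lemma abs_length_prod (ts : seq W) :
  all (mem T) ts -> (len (prodT ts) <= size ts)%N.
Proof.
by move=> Tts; apply: (abs_length_spec _).2; apply/expset_seqP; exists ts.
Qed.

Lemma abs_length1 : len 1 = 0%N.
Proof.
by apply/eqP; rewrite -leqn0; have := @abs_length_prod [::] isT; rewrite big_nil.
Qed.

Lemma abs_lengthM (u v : W) : (len (u * v) <= len u + len v)%N.
Proof.
have [us /and3P[Tus /eqP pu /eqP <-]] := reduced_exists u.
have [vs /and3P[Tvs /eqP pv /eqP <-]] := reduced_exists v.
by rewrite -size_cat -pu -pv -big_cat abs_length_prod // all_cat Tus.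
Qed.

Lemma abs_length_mul (u v w : W) : u * v = w -> (len w <= len u + len v)%N.
Proof. by move=> <-; apply: abs_lengthM. Qed.

Lemma abs_length0 (w : W) : len w = 0%N -> w = 1.
Proof.
have [ts /and3P[_ /eqP <- /eqP <-]] := reduced_exists w.
by move/size0nil ->; rewrite big_nil.
Qed.

Lemma abs_length_refl (t : W) : t \in T -> len t = 1%N.
Proof.
move=> Tt; apply/eqP; rewrite eqn_leq; apply/andP; split.
  by have := @abs_length_prod [:: t]; rewrite big_seq1 /= Tt; apply.
by rewrite lt0n; apply: contraNneq T1 => /abs_length0 <-.
Qed.

Lemma abs_lengthJ_le (w x : W) : (len (w ^ x) <= len w)%N.
Proof.
have [ts /and3P[Tts /eqP <- /eqP <-]] := reduced_exists w.
rewrite -(size_map (fun t => t ^ x)).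
have -> : prodT ts ^ x = prodT [seq t ^ x | t <- ts].
  rewrite big_map; elim: ts {Tts} => [|t ts IH]; first by rewrite !big_nil conj1g.
  by rewrite !big_cons conjMg IH.
apply: abs_length_prod; rewrite all_map; apply/allP => t ts_t /=.
by apply: conj_T; apply: (allP Tts).
Qed.

Lemma abs_lengthJ (w x : W) : len (w ^ x) = len w.
Proof.
apply/eqP; rewrite eqn_leq abs_lengthJ_le /=.
by have := abs_lengthJ_le (w ^ x) x^-1; rewrite conjgK.
Qed.

Lemma abs_le1 (w : W) : abs_le T 1 w.
Proof. by rewrite /abs_le abs_length1 add0n invg1 mul1g. Qed.

Lemma mem_NC (g w : W) : (w \in NC T g) = abs_le T w g.
Proof. by rewrite inE abs_le1. Qed.

Lemma abs_leP (u v : W) : (len u + len (u^-1 * v) <= len v)%N -> abs_le T u v.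
Proof.
move=> le_uv; rewrite /abs_le eqn_leq le_uv /=.
by have := abs_lengthM u (u^-1 * v); rewrite mulKVg.
Qed.

Lemma abs_le_refl (u : W) : abs_le T u u.
Proof. by rewrite /abs_le mulVg abs_length1 addn0. Qed.

Lemma abs_le_trans (u v w : W) : abs_le T u v -> abs_le T v w -> abs_le T u w.
Proof.
move=> /eqP uv /eqP vw; apply: abs_leP.
have : (len (u^-1 * w) <= len (u^-1 * v) + len (v^-1 * w))%N.
  by apply: abs_length_mul; rewrite mulgA mulgK.
lia.
Qed.

Lemma abs_le_anti (u v : W) : abs_le T u v -> abs_le T v u -> u = v.
Proof.
move=> /eqP uv /eqP vu; have /abs_length0/eqP : len (u^-1 * v) = 0%N by lia.
by rewrite -eq_mulVg1 => /eqP.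
Qed.

(* The middle factor [u^-1 v] of [g = u (u^-1 v) (v^-1 g)] is moved to the
   front by conjugating [u]. *)
Lemma quotient_NC (g u v : W) :
  u \in NC T g -> v \in NC T g -> abs_le T u v -> (u^-1 * v)%g \in NC T g.
Proof.
rewrite !mem_NC => /eqP ug /eqP vg /eqP uv; apply: abs_leP.
have : (len ((u^-1 * v)^-1 * g) <= len (u ^ (u^-1 * v)) + len (v^-1 * g))%N.
  apply: abs_length_mul.
  by rewrite conjgE !invMg !invgK !mulgA !mulgK.
rewrite abs_lengthJ; lia.
Qed.

Lemma reduced_NC_cat (g w : W) (ts : seq W) :
  w \in NC T g -> reduced w ts -> exists us, reduced g (ts ++ us).
Proof.
rewrite mem_NC => /eqP wg /and3P[Tts /eqP pts /eqP szts].
have [us /and3P[Tus /eqP pus /eqP szus]] := reduced_exists (w^-1 * g).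
exists us; rewrite /reduced all_cat Tts Tus big_cat /= pts pus mulKVg eqxx /=.
by rewrite size_cat szts szus wg.
Qed.

(** Left multiplication by the involution [t] strips the first letter; the length condition then
    says which [t] can start a reduced word. This is the recursion behind the inductions on
    factorisations. *)
Lemma reduced_cons (w t : W) (ts : seq W) :
  reduced w (t :: ts) = [&& t \in T, len w == (len (t * w)).+1 & reduced (t * w) ts].
Proof.
rewrite /reduced /= big_cons -andbA.
case Tt: (t \in T) => //=; case Tts: (all _ ts); rewrite ?andbF //=.
have -> : (t * prodT ts == w) = (prodT ts == t * w).
  by apply/eqP/eqP => [<-|->]; rewrite mulgA (invol_T Tt) mul1g.
case: eqP => [p|]; last by rewrite andbF.
have le_tw : (len w <= len t + len (t * w))%N.
  by apply: abs_length_mul; rewrite mulgA (invol_T Tt) mul1g.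
have : (len (t * w) <= size ts)%N by rewrite -p; apply: abs_length_prod.
move: le_tw; rewrite (abs_length_refl Tt) /=; lia.
Qed.

Lemma reduced_nil (w : W) : reduced w [::] = (w == 1).
Proof.
rewrite /reduced big_nil /= eq_sym.
by case: eqP => [->|//]; rewrite abs_length1.
Qed.

Lemma NC_tail (g w t : W) (ts : seq W) :
  w \in NC T g -> reduced w (t :: ts) -> (t * w)%g \in NC T g.
Proof.
move=> NCw; rewrite reduced_cons => /and3P[Tt /eqP lw red].
have tV : t^-1 = t by apply/eqP; rewrite eq_invg_mul invol_T.
rewrite -{1}tV; apply: quotient_NC => //; last first.
  by rewrite /abs_le tV abs_length_refl // lw.
rewrite mem_NC; apply: abs_le_trans (_ : abs_le T t w) _.
  by rewrite /abs_le tV abs_length_refl // lw.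
by rewrite -mem_NC.
Qed.

(** Moving [a] and [b] to the front conjugates the letters of [p] and [q] and keeps their number, so
    the remaining factor has length at most [len g - 2]. *)
Lemma pair_NC (g a b : W) (p q r : seq W) :
  reduced g (p ++ a :: q ++ b :: r) ->
  (a * b)%g \in NC T g /\ reduced (a * b)%g [:: a; b].
Proof.
case/and3P; rewrite !all_cat /= all_cat /= => /and5P[Tp Ta Tq Tb Tr] /eqP.
rewrite big_cat big_cons big_cat big_cons /= => gE.
rewrite !size_cat /= size_cat /= => /eqP sz; rewrite mem_NC.
have le_g : (len g <= len (a * b) + len ((a * b)^-1 * g))%N.
  by apply: abs_length_mul; rewrite mulKVg.
have le_h : (len ((a * b)^-1 * g) <= size p + (size q + size r))%N.
  have -> : (a * b)^-1 * g = prodT p ^ (a * b) * (prodT q ^ b * prodT r).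
    by rewrite -gE !conjgE !invMg !mulgA !(mulgK, mulgKV).
  apply: leq_trans (abs_lengthM _ _) _; rewrite abs_lengthJ.
  apply: leq_add; first exact: abs_length_prod.
  apply: leq_trans (abs_lengthM _ _) _; rewrite abs_lengthJ.
  by apply: leq_add; apply: abs_length_prod.
have : (len (a * b) <= len a + len b)%N by apply: abs_lengthM.
rewrite (abs_length_refl Ta) (abs_length_refl Tb) => le_ab.
split; first by apply: abs_leP; lia.
rewrite /reduced /= Ta Tb big_cons big_seq1 eqxx /=; lia.
Qed.


Lemma invg_T (t : W) : t \in T -> t^-1 = t.
Proof. by move=> Tt; apply/eqP; rewrite eq_invg_mul invol_T. Qed.

(** * Maximal chains as reduced factorisations *)

Section Chains.

Variable g : W.

Local Notation cov := (covers (abs_le T) (NC T g)).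
Local Notation maxc := (maximal_chain (abs_le T) (NC T g)).
Local Notation labels := (chain_label (@natural_label W)).

Lemma finite_poset_NC : finite_poset (abs_le T) (NC T g).
Proof.
split; first by move=> x _; apply: abs_le_refl.
  by move=> x y _ _ /andP[]; apply: abs_le_anti.
by move=> y x z _ _ _; apply: abs_le_trans.
Qed.

(** If [t] starts a reduced word of [x^-1 y], then [x t] lies between [x] and [y] and differs from
    [x], so the covering forces [y = x t]. *)
Lemma covers_NC_refl (x y : W) : cov x y -> (x^-1 * y)%g \in T.
Proof.
case/and5P => NCx NCy xy le_xy /forall_inP between.
have [[|t ts] red] := reduced_exists (x^-1 * y).
  by move: red xy; rewrite reduced_nil -eq_mulVg1 => ->.
move: red; rewrite reduced_cons => /and3P[Tt /eqP len_xy _].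
have le_xz : (len (x * t) <= len x + len t)%N by apply: abs_lengthM.
have le_y : (len y <= len (x * t) + len (t * (x^-1 * y)))%N.
  by apply: abs_length_mul; rewrite !mulgA -(mulgA x t) (invol_T Tt) mulg1 mulgV mul1g.
have zy : (x * t)^-1 * y = t * (x^-1 * y).
  by rewrite invMg (invg_T Tt) mulgA.
move: (le_xy) => /eqP le_xy'; move: le_xz; rewrite (abs_length_refl Tt) => le_xz.
have zy' : abs_le T (x * t) y by apply: abs_leP; rewrite zy; lia.
have xz' : abs_le T x (x * t).
  by apply: abs_leP; rewrite mulKg (abs_length_refl Tt); lia.
have NCz : (x * t)%g \in NC T g.
  by rewrite mem_NC; apply: abs_le_trans zy' _; rewrite -mem_NC.
have := between _ NCz; rewrite xz' zy' /= => /orP[/eqP xt|/eqP <-]; last by rewrite mulKg.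
by case/negP: T1; rewrite -(mulVg x) -{2}xt mulKg.
Qed.

Lemma path_covers_le (u : W) (c : seq W) : path cov u c -> abs_le T u (last u c).
Proof.
elim: c u => [|x c IHc] u /=; first by rewrite abs_le_refl.
by case/andP => /and5P[_ _ _ ux _] /IHc; apply: abs_le_trans.
Qed.

(** With the converse below, this turns maximal chains of [[u, v]] into reduced words of [u^-1 v]:
    labels in one direction, partial products in the other. *)
Lemma reduced_maximal_chain (u v : W) (c : seq W) :
  maxc u v c -> reduced (u^-1 * v) (labels u c).
Proof.
elim: c u => [|x c IHc] u /andP[/= pc /eqP lc].
  by rewrite lc mulVg reduced_nil.
case/andP: pc => cov_ux pc; have Tt := covers_NC_refl cov_ux.
have /IHc red : maxc x v c by apply/andP; split=> //; apply/eqP.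
have E : (u^-1 * x) * (u^-1 * v) = x^-1 * v.
  by rewrite -{1}(invg_T Tt) invMg invgK -!mulgA mulKVg.
rewrite /chain_label /= reduced_cons /natural_label Tt E red andbT /=.
have le_xv : abs_le T x v by rewrite -lc; apply: path_covers_le.
have /and5P[_ _ _ le_ux _] := cov_ux.
have /eqP h1 := abs_le_trans le_ux le_xv.
move: le_ux le_xv => /eqP h2 /eqP h3.
move: h2; rewrite (abs_length_refl Tt); lia.
Qed.

Lemma maximal_chain_reduced (u v : W) (ts : seq W) :
  v \in NC T g -> abs_le T u v -> reduced (u^-1 * v) ts ->
  maxc u v (scanl (fun x t => x * t)%g u ts).
Proof.
move=> NCv; elim: ts u => [|t ts IHts] u le_uv.
  by rewrite reduced_nil -eq_mulVg1 => /eqP ->; rewrite /maximal_chain /= eqxx.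
rewrite reduced_cons => /and3P[Tt /eqP len_uv red].
have zv : (u * t)^-1 * v = t * (u^-1 * v) by rewrite invMg (invg_T Tt) mulgA.
have le_uz : (len (u * t) <= len u + len t)%N by apply: abs_lengthM.
have le_v : (len v <= len (u * t) + len ((u * t)^-1 * v))%N.
  by apply: abs_length_mul; rewrite mulKVg.
move: (le_uv) => /eqP le_uv'; move: le_uz; rewrite (abs_length_refl Tt) => le_uz.
have len_z : len (u * t) = (len u).+1 by move: le_v; rewrite zv; lia.
have zv' : abs_le T (u * t) v by apply: abs_leP; rewrite zv; lia.
have NCu : u \in NC T g.
  by rewrite mem_NC; apply: abs_le_trans le_uv _; rewrite -mem_NC.
have NCz : (u * t)%g \in NC T g.
  by rewrite mem_NC; apply: abs_le_trans zv' _; rewrite -mem_NC.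
have uz' : abs_le T u (u * t).
  by apply: abs_leP; rewrite mulKg (abs_length_refl Tt); lia.
have /andP[pc lc] : maxc (u * t) v (scanl (fun x s => x * s)%g (u * t) ts).
  by apply: IHts => //; rewrite zv.
apply/andP; split=> //=; rewrite pc andbT; apply/and5P; split=> //.
  by apply/eqP => ut; move: len_z; rewrite -ut; apply: n_Sn.
apply/forall_inP => z NCz'; apply/implyP => /andP[/eqP uz /eqP zt].
(* An element between [u] and [u t] splits the length 1 in two, so one of the two quotients is
   trivial. *)
have : (len (u^-1 * z) + len (z^-1 * (u * t)))%N == 1%N.
  by rewrite -(eqn_add2l (len u)) addnA uz zt len_z addn1.
rewrite addn_eq1 => /orP[/andP[_ /eqP/abs_length0/eqP]|/andP[/eqP/abs_length0/eqP]].
  by rewrite -eq_mulVg1 => ->; rewrite orbT.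
by rewrite -eq_mulVg1 eq_sym => ->.
Qed.

Lemma natural_labelK (u : W) (ts : seq W) :
  labels u (scanl (fun x t => x * t)%g u ts) = ts.
Proof. by rewrite /chain_label scanlK // => x t; apply: mulKg. Qed.

Lemma labels_inj (u : W) : injective (labels u).
Proof.
apply: (@can_inj _ _ _ (scanl (fun x t => x * t)%g u)).
by apply: pairmapK => x y; apply: mulKVg.
Qed.

Lemma bounded_graded_NC : bounded_graded (abs_le T) (NC T g).
Proof.
exists 1, g; split.
- by rewrite mem_NC abs_le1.
- by rewrite mem_NC abs_le_refl.
- by move=> x; rewrite mem_NC abs_le1.
move=> c c' /reduced_maximal_chain/and3P[_ _ /eqP].
rewrite /chain_label size_pairmap => -> /reduced_maximal_chain/and3P[_ _ /eqP].
by rewrite size_pairmap => ->.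
Qed.

End Chains.

(** * Lexicographically smallest and rising factorisations *)

Section LexSmallest.

Variable lt : rel W.
Hypothesis lt_total : strict_total_order_on T lt.

Lemma exists_first (S : {set W}) (t0 : W) : S \subset T -> t0 \in S ->
  exists2 t, t \in S & {in S, forall s, (t == s) || lt t s}.
Proof.
have [irr tr tot] := lt_total.
elim: {S}_.+1 {-2}S (ltnSn #|S|) t0 => // n IHn S leSn t0 ST St0.
have [S1|] := set_0Vmem (S :\ t0).
  exists t0 => // s Ss; have : s \notin S :\ t0 by rewrite S1 inE.
  by rewrite !inE Ss andbT negbK eq_sym => ->.
case=> s Ss; have [|||t] := IHn (S :\ t0) _ s => //.
- by rewrite (cardsD1 t0) St0 in leSn.
- exact: fintype.subset_trans (subsetDl _ _) ST.
rewrite !inE => /andP[tt0 St] mint.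
have [Tt Tt0] := (fintype.subsetP ST _ St, fintype.subsetP ST _ St0).
have /orP[lt_t|lt_t0] := tot _ _ Tt Tt0 tt0.
  exists t => // x Sx; have [->|xt0] := eqVneq x t0; first by rewrite lt_t orbT.
  by apply: mint; rewrite !inE xt0.
exists t0 => // x Sx; have [//|xt0] := eqVneq t0 x.
have /orP[/eqP <-//|lt_tx] : (t == x) || lt t x.
  by apply: mint; rewrite !inE eq_sym xt0.
by rewrite (tr t t0 x) // (fintype.subsetP ST).
Qed.

(* A descent [t0 > t1] at the front of a factorisation could be improved by the
   Hurwitz move [t0 t1 = t1 (t1 t0 t1)], so the smallest one is rising. *)
Lemma lex_smallest_reduced (w : W) : exists ts,
  [/\ reduced w ts, forall ts', reduced w ts' -> lex_le lt ts ts' & sorted lt ts].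
Proof.
have [irr tr tot] := lt_total.
have [n lew] := ubnP (len w); elim: n w lew => // n IHn w; rewrite ltnS => lew.
have [[|t ts] red] := reduced_exists w; first by exists [::].
have := red; rewrite reduced_cons => /and3P[Tt lenw _].
(* The possible first letters of reduced words of [w]; the greedy choice takes the smallest. *)
pose S := [set s : W | (s \in T) && (len w == (len (s * w)%g).+1)].
have ST : S \subset T by apply/fintype.subsetP => s; rewrite inE => /andP[].
have [t0] : exists2 t0, t0 \in S & {in S, forall s, (t0 == s) || lt t0 s}.
  by apply: (@exists_first S t) => //; rewrite inE Tt.
rewrite inE => /andP[Tt0 /eqP/= len0'] min0.
have len0 : len w = (len (t0 * w)).+1 by [].
have [ts0 [red0 lex0 sort0]] : exists ts, [/\ reduced (t0 * w) ts,
    forall ts', reduced (t0 * w) ts' -> lex_le lt ts ts' & sorted lt ts].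
  by apply: IHn; move: lew; rewrite len0; lia.
exists (t0 :: ts0); split; first by rewrite reduced_cons Tt0 -len0 eqxx.
  case=> [|t' ts']; first by rewrite reduced_nil => /eqP w1; move: len0; rewrite w1 abs_length1.
  rewrite reduced_cons => /and3P[Tt' len' red'] /=.
  have /orP[/eqP E|->//] : (t0 == t') || lt t0 t' by apply: min0; rewrite inE Tt'.
  by rewrite E eqxx lex0 ?orbT // E.
case: ts0 red0 {lex0} sort0 => [|t1 ts1] //=; rewrite reduced_cons.
case/and3P => Tt1 /eqP/= len1' _ ->; rewrite andbT.
have len1 : len (t0 * w) = (len (t1 * (t0 * w))).+1 by [].
have Tc : t0 ^ t1 \in T by apply: conj_T.
have le1 : (len (t1 * w) <= len (t0 ^ t1) + len (t1 * (t0 * w)))%N.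
  apply: abs_length_mul; rewrite conjgE !mulgA -(mulgA _ t1 t1) (invol_T Tt1) mulg1.
  by rewrite -(mulgA _ t0 t0) (invol_T Tt0) mulg1 (invg_T Tt1).
have le2 : (len w <= len t1 + len (t1 * w))%N.
  by apply: abs_length_mul; rewrite mulgA (invol_T Tt1) mul1g.
have /orP[/eqP E|//] : (t0 == t1) || lt t0 t1.
  apply: min0; rewrite inE Tt1 /=; move: le1 le2; rewrite len0 len1.
  rewrite (abs_length_refl Tc) (abs_length_refl Tt1) => le1 le2.
  suff -> : len (t1 * w) = (len (t1 * (t0 * w))).+1 by [].
  lia.
have E1 : t1 * (t0 * w) = w by rewrite E mulgA (invol_T Tt1) mul1g.
by move: len1 len0; rewrite E1; lia.
Qed.

Lemma lex_le_anti (s t : seq W) : all (mem T) s -> all (mem T) t ->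
  lex_le lt s t -> lex_le lt t s -> s = t.
Proof.
have [irr tr tot] := lt_total.
elim: s t => [|x s IHs] [|y t] //= /andP[Tx Ts] /andP[Ty Tt].
case/orP => [xy|/andP[/eqP <- st]].
  case/orP => [yx|/andP[/eqP E _]].
    by have := irr _ Tx; rewrite (tr _ _ _ Ty Tx Tx xy yx).
  by have := irr _ Tx; rewrite -{2}E xy.
by rewrite (negPf (irr _ Tx)) eqxx /= => ts; rewrite (IHs t).
Qed.

Lemma lex_smallest_chain (g u v : W) :
  v \in NC T g -> abs_le T u v ->
  exists2 c : seq W,
    unique (lex_smallest (abs_le T) (NC T g) lt (@natural_label W) u v) c
    & rising lt (@natural_label W) u c.
Proof.
move=> NCv le_uv; have [ts [red lex srt]] := lex_smallest_reduced (u^-1 * v).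
have chainc := maximal_chain_reduced NCv le_uv red.
exists (scanl (fun x t => x * t)%g u ts); last by rewrite /rising natural_labelK.
split.
  by split=> // c' /reduced_maximal_chain; rewrite natural_labelK; apply: lex.
move=> c' [chainc' lexc']; apply: (@labels_inj u).
have red' := reduced_maximal_chain chainc'.
rewrite natural_labelK; apply: lex_le_anti.
- by case/and3P: red.
- by case/and3P: red'.
- exact: lex.
by have := lexc' _ chainc; rewrite natural_labelK.
Qed.

(* Rising factorisations are unique as soon as the first letter of any of them
   is the smallest reflection below the factored element. *)
Lemma EL_labeling_NC (g : W) :
  (forall w t ts t', w \in NC T g -> reduced w (t :: ts) -> sorted lt (t :: ts) ->
     t' \in T -> len w = (len (t' * w)).+1 -> (t == t') || lt t t') ->
  EL_labeling (abs_le T) (NC T g) T lt (@natural_label W).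
Proof.
have [irr tr tot] := lt_total => first_min.
have uniq_rising : forall ts w ts', w \in NC T g -> reduced w ts -> reduced w ts' ->
    sorted lt ts -> sorted lt ts' -> ts = ts'.
  elim=> [|t ts IHts] w [|t' ts'] NCw red red' srt srt' //.
  - by case/and3P: red' => _ _; case/and3P: red => _ _ /eqP <-.
  - by case/and3P: red => _ _; case/and3P: red' => _ _ /eqP <-.
  have := red; have := red'; rewrite !reduced_cons.
  case/and3P => Tt' /eqP len' redt' /and3P[Tt /eqP lent redt].
  have le1 := first_min _ _ _ _ NCw red srt Tt' len'.
  have le2 := first_min _ _ _ _ NCw red' srt' Tt lent.
  have tt' : t = t'.
    case/orP: le1 => [/eqP //|lt1]; case/orP: le2 => [/eqP //|lt2].
    by have := irr _ Tt; rewrite (tr _ _ _ Tt' Tt Tt lt1 lt2).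
  rewrite -tt' in redt' *; congr (_ :: _); apply: (IHts (t * w)) => //.
  - exact: NC_tail NCw red.
  - by case: (ts) srt => //= ? ? /andP[].
  - by case: (ts') srt' => //= ? ? /andP[].
split; first exact: finite_poset_NC.
- exact: bounded_graded_NC.
- exact: covers_NC_refl.
move=> u v NCu NCv le_uv _; have [c [lexc _] risc] := lex_smallest_chain NCv le_uv.
exists c => //; split; first by split=> //; case: lexc.
move=> c' [chainc' risc']; apply: (@labels_inj u).
apply: uniq_rising (quotient_NC NCu NCv le_uv) _ _ risc risc'.
  by case: lexc => /reduced_maximal_chain.
exact: reduced_maximal_chain chainc'.
Qed.

End LexSmallest.

End AbsoluteLength.

(** * Reflections of Euclidean space *)

Section Euclidean.

Set Implicit Arguments.
Unset Strict Implicit.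
Unset Printing Implicit Defensive.

Import Order.TTheory GRing.Theory Num.Theory.
Local Open Scope ring_scope.

Variables (R : realType) (l : nat).
Implicit Types (a b x y : 'cV[R]_l) (B : seq 'cV[R]_l).

Lemma dotvE x y : dotv x y = \sum_i x i 0 * y i 0.
Proof. by rewrite /dotv mxE; apply: eq_bigr => i _; rewrite mxE. Qed.

Lemma dotvC x y : dotv x y = dotv y x.
Proof. by rewrite !dotvE; apply: eq_bigr => i _; rewrite mulrC. Qed.

Lemma dotvDr x y z : dotv x (y + z) = dotv x y + dotv x z.
Proof. by rewrite /dotv mulmxDr mxE. Qed.

Lemma dotvZr k x y : dotv x (k *: y) = k * dotv x y.
Proof. by rewrite /dotv -scalemxAr mxE. Qed.

Lemma dotvDl x y z : dotv (x + y) z = dotv x z + dotv y z.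
Proof. by rewrite dotvC dotvDr !(dotvC z). Qed.

Lemma dotvZl k x y : dotv (k *: x) y = k * dotv x y.
Proof. by rewrite dotvC dotvZr dotvC. Qed.

Lemma dotvNl x y : dotv (- x) y = - dotv x y.
Proof. by rewrite -scaleN1r dotvZl mulN1r. Qed.

Lemma dotvNr x y : dotv x (- y) = - dotv x y.
Proof. by rewrite dotvC dotvNl dotvC. Qed.

Lemma dotv0l x : dotv 0 x = 0.
Proof. by rewrite -(scale0r 0) dotvZl mul0r. Qed.

Lemma dotv_suml (I : Type) (s : seq I) (F : I -> 'cV[R]_l) y :
  dotv (\sum_(i <- s) F i) y = \sum_(i <- s) dotv (F i) y.
Proof.
elim: s => [|i s IHs]; first by rewrite !big_nil dotv0l.
by rewrite !big_cons dotvDl IHs.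
Qed.

Lemma dotv_sumr (I : Type) (s : seq I) (F : I -> 'cV[R]_l) y :
  dotv y (\sum_(i <- s) F i) = \sum_(i <- s) dotv y (F i).
Proof. by rewrite dotvC dotv_suml; apply: eq_bigr => i _; rewrite dotvC. Qed.

Lemma dotv_ge0 x : 0 <= dotv x x.
Proof. by rewrite dotvE sumr_ge0 // => i _; rewrite -expr2 sqr_ge0. Qed.

Lemma dotv_eq0 x : (dotv x x == 0) = (x == 0).
Proof.
apply/eqP/eqP => [xx|->]; last exact: dotv0l.
apply/colP => i; rewrite mxE; apply/eqP; rewrite -sqrf_eq0 expr2.
move: xx; rewrite dotvE => /eqP; rewrite psumr_eq0; last first.
  by move=> j _; rewrite -expr2 sqr_ge0.
by move/allP/(_ i); rewrite mem_index_enum => /(_ isT).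
Qed.

Lemma dotv_gt0 x : x != 0 -> 0 < dotv x x.
Proof. by move=> x0; rewrite lt_def dotv_eq0 x0 dotv_ge0. Qed.

Lemma dotv_mulmx (A : 'M[R]_l) x y : dotv (A *m x) y = dotv x (A^T *m y).
Proof. by rewrite /dotv trmx_mul mulmxA. Qed.

Lemma reflmxE a x : reflmx a *m x = x - (2 * dotv a x / dotv a a) *: a.
Proof.
rewrite /reflmx mulmxBl mul1mx -scalemxAl -mulmxA.
have -> : a^T *m x = (dotv a x)%:M by rewrite /dotv -mx11_scalar.
rewrite mul_mx_scalar scalerA; congr (_ - _ *: _).
by rewrite mulrAC.
Qed.

Lemma reflmxN a : reflmx (- a) = reflmx a.
Proof.
by rewrite /reflmx dotvNl dotvNr opprK linearN /= mulNmx mulmxN opprK.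
Qed.

Lemma reflmxZ k a : k != 0 -> reflmx (k *: a) = reflmx a.
Proof.
move=> k0; rewrite /reflmx dotvZl dotvZr.
have -> : (k *: a)^T = k *: a^T by apply/matrixP => i j; rewrite !mxE.
rewrite -scalemxAl -scalemxAr.
rewrite !scalerA; congr (_ - _ *: _).
have [->|aa0] := eqVneq (dotv a a) 0; first by rewrite !(mulr0, invr0, mul0r).
by field; rewrite k0 aa0.
Qed.

Lemma reflmx_self a : a != 0 -> reflmx a *m a = - a.
Proof.
move=> a0; rewrite reflmxE mulfK ?dotv_eq0 //.
by rewrite -[X in X - _]scale1r -scalerBl -scaleN1r; congr (_ *: _); ring.
Qed.

Lemma reflmx_neq1 a : a != 0 -> reflmx a != 1%:M.
Proof.
move=> a0; apply/eqP => E; have := reflmx_self a0; rewrite E mul1mx => /eqP.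
by rewrite -subr_eq0 opprK -mulr2n -scaler_nat scaler_eq0 pnatr_eq0 (negPf a0).
Qed.

Lemma reflmxK a : a != 0 -> reflmx a *m reflmx a = 1%:M.
Proof.
move=> a0; apply/matrixP => i j.
suff E (v : 'cV[R]_l) : reflmx a *m (reflmx a *m v) = v.
  have := congr1 (fun u : 'cV[R]_l => u i 0) (E (delta_mx j 0)).
  by rewrite mulmxA -colE mxE !mxE eqxx andbT.
rewrite {1}reflmxE reflmxE dotvDr dotvNr dotvZr -addrA -opprD -scalerDl.
rewrite -[RHS]subr0; congr (_ - _); apply/eqP; rewrite scaler_eq0; apply/orP; left.
by apply/eqP; field; rewrite dotv_eq0.
Qed.

Lemma reflmxJ (A : 'M[R]_l) a : A^T *m A = 1%:M -> A *m A^T = 1%:M ->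
  reflmx (A *m a) = A *m reflmx a *m A^T.
Proof.
move=> AtA AAt; rewrite /reflmx dotv_mulmx mulmxA AtA mul1mx mulmxBr mulmxBl mulmx1 AAt.
by rewrite trmx_mul -scalemxAr -scalemxAl !mulmxA.
Qed.

Lemma free_coef0 B (c : 'cV[R]_l -> R) :
  free B -> \sum_(b <- B) c b *: b = 0 -> {in B, forall b, c b = 0}.
Proof.
elim: B => [|b B IHB] //; rewrite free_cons big_cons => /andP[bB freeB] E.
have cb : c b = 0.
  apply/eqP; apply: contraNT bB => cb.
  have -> : b = (c b)^-1 *: (c b *: b) by rewrite scalerA mulVf // scale1r.
  move/eqP: E; rewrite addr_eq0 => /eqP ->; rewrite memvZ // rpredN.
  by rewrite big_seq memv_suml // => x xB; rewrite memvZ // memv_span.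
rewrite cb scale0r add0r in E => x; rewrite inE => /orP[/eqP -> //|].
exact: IHB freeB E x.
Qed.

Lemma span_coef B x : uniq B -> x \in <<B>>%VS ->
  exists c : 'cV[R]_l -> R, x = \sum_(b <- B) c b *: b.
Proof.
elim: B x => [|b B IHB] x.
  by rewrite span_nil memv0 => _ /eqP ->; exists (fun=> 0); rewrite big_nil.
case/andP => bB uB; rewrite span_cons => /memv_addP[y /vlineP[k ->]].
case=> z /(IHB _ uB)[c ->] ->.
exists (fun v => if v == b then k else c v); rewrite big_cons eqxx; congr (_ + _).
apply: eq_big_seq => v vB; case: eqP => // vb.
by rewrite -vb vB in bB.
Qed.

Lemma sum_in_span B (c : 'cV[R]_l -> R) : \sum_(b <- B) c b *: b \in <<B>>%VS.
Proof. by rewrite big_seq memv_suml // => x xB; rewrite memvZ // memv_span. Qed.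

Lemma nneg_comb_span B x : nneg_comb B x -> x \in <<B>>%VS.
Proof. by case=> c _ ->; apply: sum_in_span. Qed.

(** * Products of reflections in linearly independent vectors *)

Section ReflectionProducts.

Local Notation rp B := (\big[mulmx/1%:M]_(b <- B) reflmx b).

Lemma rp_cons a B : rp (a :: B) = reflmx a *m rp B.
Proof. by rewrite big_cons. Qed.

(** Each reflection moves a vector only along its own root. *)
Lemma sub_rp_span B x : x - rp B *m x \in <<B>>%VS.
Proof.
elim: B x => [|b B IHB] x; first by rewrite big_nil mul1mx subrr mem0v.
rewrite rp_cons -mulmxA reflmxE opprB addrC -addrA (addrC (- _)).
rewrite span_cons memv_add //; by rewrite memvZ // memv_line.
Qed.

(** If the first reflection contributed a nonzero multiple of [b], that multiple would have to be
    cancelled by the others, putting [b] in the span of the remaining roots. *)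
Lemma rp_fixed_orthogonal B x : free B -> rp B *m x = x ->
  {in B, forall b, dotv b x = 0}.
Proof.
elim: B => [|b B IHB] //; rewrite free_cons => /andP[bB freeB].
rewrite rp_cons -mulmxA reflmxE; set k := _ / _ => E.
have k0 : k = 0.
  apply/eqP; apply: contraNT bB => k0.
  have -> : b = (- k^-1) *: (x - rp B *m x).
    rewrite -{1}E addrAC subrr add0r scalerN scaleNr opprK scalerA mulVf //.
    by rewrite scale1r.
  by rewrite memvZ // sub_rp_span.
rewrite k0 scale0r subr0 in E => a; rewrite inE => /orP[/eqP ->|]; last exact: IHB.
have b0 : b != 0 by apply: contraNneq bB => ->; rewrite mem0v.
move: k0; rewrite /k E => /eqP; rewrite mulf_eq0 invr_eq0 dotv_eq0 (negPf b0) orbF.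
by rewrite mulf_eq0 pnatr_eq0 => /eqP.
Qed.

(** Let [z] be the image of [x] under the factors from [b] on. Then [b - (x - z)] equals
    [z - rp B1 *m z], so it lies in the spans of both [B1] and [b :: B2] and vanishes. In
    [x - z = b] the reflection in [b] must contribute exactly [b], else [b] would lie in the span of
    [B2]; hence [rp B2] fixes [x]. *)
Lemma rp_sub_eq B1 b B2 x : free (B1 ++ b :: B2) ->
  x - rp (B1 ++ b :: B2) *m x = b -> {in B2, forall c, dotv c x = 0}.
Proof.
have rp_cat B B' : rp (B ++ B') = rp B *m rp B'.
  elim: B => [|c B IHB]; first by rewrite big_nil mul1mx.
  by rewrite cat_cons !rp_cons IHB mulmxA.
rewrite cat_free => /and3P[free1 free2 dir] E.
pose z := rp (b :: B2) *m x.
have E1 : (z - rp B1 *m z) = b - (x - z).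
  by rewrite rp_cat -mulmxA -/z in E; rewrite -{1}E opprB [RHS]addrC addrA subrK.
have z0 : b - (x - z) = 0.
  apply/eqP; rewrite -memv0 -(directv_addP dir) memv_cap -{1}E1 sub_rp_span /=.
  by rewrite rpredB ?sub_rp_span // memv_span // mem_head.
move: free2; rewrite free_cons => /andP[bB freeB].
have {z0} : b = x - z by apply/eqP; rewrite -subr_eq0 z0.
rewrite /z rp_cons -mulmxA reflmxE opprB addrC -addrA (addrC (- _)).
set k := _ / _ => E2.
have k1 : k = 1.
  apply/eqP; apply: contraNT bB; rewrite -subr_eq0 => k1.
  have -> : b = (1 - k)^-1 *: (x - rp B2 *m x).
    have -> : x - rp B2 *m x = (1 - k) *: b.
      by rewrite scalerBl scale1r {1}E2 addrAC subrr add0r.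
    by rewrite scalerA mulVf ?scale1r // -oppr_eq0 opprB.
  by rewrite memvZ // sub_rp_span.
apply: rp_fixed_orthogonal => //; apply/eqP; rewrite eq_sym -subr_eq0.
by move/eqP: E2; rewrite k1 scale1r -{1}[b]addr0 (inj_eq (addrI _)) eq_sym.
Qed.

End ReflectionProducts.

End Euclidean.

(** * The bilinear form of a Coxeter element *)

Section WallForm.

Set Implicit Arguments.
Unset Strict Implicit.
Unset Printing Implicit Defensive.

Import Order.TTheory GRing.Theory Num.Theory.
Local Open Scope ring_scope.

Variables (R : realType) (l : nat).
Implicit Types (a b x y : 'cV[R]_l) (B : seq 'cV[R]_l).

Local Notation rp B := (\big[mulmx/1%:M]_(b <- B) reflmx b).

Lemma unitmx_ker (A : 'M[R]_l) :
  (forall x : 'cV[R]_l, A *m x = 0 -> x = 0) -> A \in unitmx.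
Proof.
move=> ker0; rewrite -unitmx_tr -row_free_unit -kermx_eq0.
apply/rowV0P => v /sub_kermxP vA; apply: trmx_inj; rewrite trmx0.
by apply: ker0; rewrite -[A]trmxK -trmx_mul vA trmx0.
Qed.

(* The form [E] above is [wall ((1 - g)^-1)]. *)
Definition wall (M : 'M[R]_l) x y : R := dotv x (M *m y).

Variable M : 'M[R]_l.

Lemma wallDl x y z : wall M (x + y) z = wall M x z + wall M y z.
Proof. exact: dotvDl. Qed.

Lemma wallDr x y z : wall M x (y + z) = wall M x y + wall M x z.
Proof. by rewrite /wall mulmxDr dotvDr. Qed.

Lemma wallZl k x y : wall M (k *: x) y = k * wall M x y.
Proof. exact: dotvZl. Qed.

Lemma wallZr k x y : wall M x (k *: y) = k * wall M x y.
Proof. by rewrite /wall -scalemxAr dotvZr. Qed.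

Lemma wallNl x y : wall M (- x) y = - wall M x y.
Proof. exact: dotvNl. Qed.

Lemma wallNr x y : wall M x (- y) = - wall M x y.
Proof. by rewrite /wall mulmxN dotvNr. Qed.

Lemma wall_suml (s : seq 'cV[R]_l) (c : 'cV[R]_l -> R) y :
  wall M (\sum_(a <- s) c a *: a) y = \sum_(a <- s) c a * wall M a y.
Proof. by rewrite /wall dotv_suml; apply: eq_bigr => a _; rewrite dotvZl. Qed.

Lemma wall_sumr (s : seq 'cV[R]_l) (c : 'cV[R]_l -> R) y :
  wall M y (\sum_(a <- s) c a *: a) = \sum_(a <- s) c a * wall M y a.
Proof.
rewrite /wall mulmx_sumr dotv_sumr; apply: eq_bigr => a _.
by rewrite -scalemxAr dotvZr.
Qed.

Definition wall_triangular B : bool := pairwise (fun b c => wall M c b == 0) B.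

(** * The form attached to [(1 - G)^-1] *)

Section CoxeterForm.

Variable G : 'M[R]_l.
Hypothesis unitG : 1%:M - G \in unitmx.
Hypothesis MG : M = invmx (1%:M - G).

(** The Cayley transform [2 M - 1] of an orthogonal matrix is skew, which amounts to
    [M + M^T = 1]. *)
Lemma wall_symm x y : G^T *m G = 1%:M -> wall M x y + wall M y x = dotv x y.
Proof.
move=> GtG; rewrite /wall (dotvC y) dotv_mulmx -dotvDr -mulmxDl.
suff -> : M + M^T = 1%:M by rewrite mul1mx.
have MI : M *m (1%:M - G) = 1%:M by rewrite MG mulVmx.
have ME : M = 1%:M + M *m G by rewrite -[X in X + _]MI mulmxBr mulmx1 subrK.
have MtI : (1%:M - G)^T *m M^T = 1%:M by rewrite -trmx_mul MI trmx1.
apply: (row_free_inj (A := 1%:M - G)); first by rewrite row_free_unit.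
rewrite mul1mx mulmxDl MI.
suff -> : M^T *m (1%:M - G) = - G by [].
have unitGt : (1%:M - G)^T \in unitmx by rewrite unitmx_tr.
apply: (can_inj (mulKmx unitGt)); rewrite mulmxA MtI mul1mx linearB /= trmx1.
by rewrite mulmxBl mul1mx mulmxN GtG opprK addrC.
Qed.

(** Every vector is in the image of [1 - G], which [sub_rp_span] places in the span of [B]. *)
Lemma full_span B : rp B = G -> <<B>>%VS = fullv.
Proof.
move=> rpB; apply/vspaceP => x; rewrite memvf.
have -> : x = (M *m x) - rp B *m (M *m x); last exact: sub_rp_span.
by rewrite rpB -[X in X - _]mul1mx -mulmxBl mulmxA MG mulmxV // mul1mx.
Qed.

(** This is [rp_sub_eq] at [x = M b]; the prefix [B1] collects the roots already passed in the
    induction. *)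
Lemma wall_triangular_cat B1 B2 : free (B1 ++ B2) -> rp (B1 ++ B2) = G ->
  wall_triangular B2.
Proof.
elim: B2 B1 => [|b B2 IHB] B1 // freeB rpB; rewrite /wall_triangular /=.
apply/andP; split; last by apply: (IHB (rcons B1 b)); rewrite cat_rcons.
apply/allP => c cB2; apply/eqP; apply: (rp_sub_eq freeB) cB2.
by rewrite rpB -[X in X - _]mul1mx -mulmxBl mulmxA MG mulmxV // mul1mx.
Qed.

(** Exhibits [b] in the image of [1 - w] for the prefix [w] of [G] starting with [b]. By
    triangularity [M b] is orthogonal to [B1], hence fixed by its reflections, and the reflection in
    [b] subtracts exactly [b] because [2 wall M b b = (b,b)]. *)
Lemma wall_reflection_prefix b B1 B2 : free (b :: B1 ++ B2) ->
  rp (b :: B1 ++ B2) = G -> (forall x y, wall M x y + wall M y x = dotv x y) ->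
  M *m b - rp (b :: B1) *m (M *m b) = b.
Proof.
move=> freeB rpB symM; have := freeB; rewrite free_cons => /andP[bB _].
have b0 : b != 0 by apply: contraNneq bB => ->; rewrite mem0v.
have tri : wall_triangular (b :: B1 ++ B2).
  by apply: (@wall_triangular_cat [::]).
have fixB : rp B1 *m (M *m b) = M *m b.
  have : {in B1, forall c, dotv c (M *m b) = 0}.
    move=> c cB; case/andP: tri => /allP/(_ c) tri _; apply/eqP/tri.
    by rewrite mem_cat cB.
  elim: (B1) => [|c C IHC] orth; first by rewrite big_nil mul1mx.
  rewrite big_cons -mulmxA IHC => [|d dC]; last by apply: orth; rewrite inE dC orbT.
  by rewrite reflmxE orth ?mem_head // mulr0 mul0r scale0r subr0.
rewrite big_cons -mulmxA fixB reflmxE opprB addrC subrK.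
have -> : 2 * dotv b (M *m b) = dotv b b.
  by rewrite -[RHS]symM /wall; ring.
by rewrite divff ?dotv_eq0 // scale1r.
Qed.

End CoxeterForm.

(** Forward substitution: the equation at the head of [s] contains only the head coefficient, which
    can then be subtracted from the other equations. *)
Lemma unitriangular_int (T : eqType) (s : seq T) (e : T -> T -> R) (c : T -> R) :
  {in s &, forall i j, e i j \is a Num.int} -> {in s, forall i, e i i = 1} ->
  pairwise (fun i j => e j i == 0) s ->
  {in s, forall j, \sum_(i <- s) c i * e i j \is a Num.int} ->
  {in s, forall i, c i \is a Num.int}.
Proof.
elim: s => [|j s IHs] // int_e diag_e /andP[/allP tri0 tri] int_sum.
have int_j : c j \is a Num.int.
  have := int_sum j (mem_head _ _); rewrite big_cons diag_e ?mem_head // mulr1.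
  by rewrite big_seq big1 ?addr0 // => i /tri0/eqP ->; rewrite mulr0.
have sub_s (x : T) : x \in s -> x \in j :: s by rewrite inE orbC => ->.
move=> x; rewrite inE => /orP[/eqP -> //|xs].
apply: IHs xs => // [a a' /sub_s ? /sub_s|a /sub_s|a as_].
- exact: int_e.
- exact: diag_e.
have := int_sum a (sub_s _ as_); rewrite big_cons => int_a.
have -> : \sum_(i <- s) c i * e i a =
    (c j * e j a + \sum_(i <- s) c i * e i a) - c j * e j a by rewrite addrC addKr.
by rewrite rpredB // rpredM // int_e ?mem_head // sub_s.
Qed.

(** * Roots and integrality of the form *)

Section RootSet.

Variable Phi : set 'cV[R]_l.
Hypothesis Phi_neq0 : forall a, Phi a -> a != 0.
Hypothesis PhiN : forall a, Phi a -> Phi (- a).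
Hypothesis Phi_reflmx_inj :
  forall a b, Phi a -> Phi b -> reflmx a = reflmx b -> b = a \/ b = - a.
Hypothesis Phi_refl : forall a b, Phi a -> Phi b -> Phi (reflmx a *m b).
Hypothesis symM : forall x y, wall M x y + wall M y x = dotv x y.

Definition wall_integral : Prop := forall x y, Phi x -> Phi y ->
  2 * wall M x y / dotv x x \is a Num.int /\ 2 * wall M x y / dotv y y \is a Num.int.

Lemma wallxx x : 2 * wall M x x = dotv x x.
Proof. by rewrite -[RHS]symM; ring. Qed.

Lemma root_proportional a k : Phi a -> Phi (k *: a) -> k *: a = a \/ k *: a = - a.
Proof.
move=> Pa Pka; apply: Phi_reflmx_inj => //; rewrite reflmxZ //.
by apply: contraTneq (Phi_neq0 Pka) => ->; rewrite scale0r eqxx.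
Qed.

(* Write a root as [x = p - q] with [p], [q] the positive and negative parts.
   By integrality [(p,p)/(x,x)] and [(q,q)/(x,x)] are integers, and their sum is
   at most 1 because [(p,q) <= 0]. *)
Lemma obtuse_simple B x :
  wall_integral -> {in B, forall b, Phi b} -> free B -> wall_triangular B ->
  {in B &, forall a b, a != b -> dotv a b <= 0} ->
  Phi x -> x \in <<B>>%VS -> nneg_comb B x \/ nneg_comb B (- x).
Proof.
move=> intM PB freeB tri obtuse Px xB.
have uB := free_uniq freeB; have [c xE] := span_coef uB xB.
have B0 b : b \in B -> dotv b b != 0 by move/PB/Phi_neq0; rewrite dotv_eq0.
have x0 : dotv x x != 0 by rewrite dotv_eq0 Phi_neq0.
have xgt0 : 0 < dotv x x by rewrite dotv_gt0 // Phi_neq0.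
have int_c : {in B, forall b, c b \is a Num.int}.
  apply: (unitriangular_int (e := fun a b => 2 * wall M a b / dotv b b)).
  - by move=> a b aB bB; have [] := intM a b (PB _ aB) (PB _ bB).
  - by move=> b bB; rewrite wallxx divff ?B0.
  - apply: sub_pairwise tri => a b /eqP ->.
    by rewrite mulr0 mul0r.
  move=> b bB; have [_] := intM x b Px (PB _ bB).
  rewrite xE wall_suml mulr_sumr mulr_suml; congr (_ \is a Num.int).
  by apply: eq_bigr => a _; ring.
(* These are the coordinates of the coroot of [x] in the coroots of [B]. *)
have int_d : {in B, forall b, c b * dotv b b / dotv x x \is a Num.int}.
  apply: (unitriangular_int (e := fun a b => 2 * wall M a b / dotv a a)).
  - by move=> a b aB bB; have [] := intM a b (PB _ aB) (PB _ bB).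
  - by move=> b bB; rewrite wallxx divff ?B0.
  - apply: sub_pairwise tri => a b /eqP ->.
    by rewrite mulr0 mul0r.
  move=> b bB; have [+ _] := intM x b Px (PB _ bB).
  rewrite {1}xE wall_suml mulr_sumr mulr_suml; congr (_ \is a Num.int).
  by apply: eq_big_seq => a aB; field; rewrite x0 B0.
pose part (s : R) := \sum_(b <- B) Num.max (s * c b) 0 *: b.
have int_part s : s = 1 \/ s = -1 -> dotv (part s) (part s) / dotv x x \is a Num.int.
  move=> s1; rewrite -wallxx /part wall_suml mulr_sumr mulr_suml big_seq.
  rewrite rpred_sum // => a aB; rewrite wall_sumr mulr_sumr mulr_sumr mulr_suml.
  rewrite big_seq rpred_sum // => b bB.
  have int_s : s \is a Num.int by case: s1 => ->; rewrite ?rpredN rpred1.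
  (* Each term of [(p,p)/(x,x)], or of [(q,q)/(x,x)], is a truncated coroot coordinate times a
     truncated root coordinate times an integral value of the form. *)
  have -> : 2 * (Num.max (s * c a) 0 * (Num.max (s * c b) 0 * wall M a b)) / dotv x x =
    (Num.max (s * c a) 0 * dotv a a / dotv x x) * Num.max (s * c b) 0 *
    (2 * wall M a b / dotv a a) by field; rewrite x0 B0.
  have int_max u : u \is a Num.int -> Num.max (s * u) 0 \is a Num.int.
    by move=> int_u; rewrite /Num.max; case: ifP => _; rewrite ?rpred0 ?rpredM.
  rewrite rpredM ?(intM a b (PB _ aB) (PB _ bB)).1 //.
  rewrite rpredM //; last by rewrite int_max ?int_c.
  rewrite /Num.max; case: ifP => _; first by rewrite !mul0r rpred0.
  by rewrite -!mulrA rpredM // mulrA int_d.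
have x_part : x = part 1 - part (-1).
  rewrite xE /part -sumrB; apply: eq_bigr => b _; rewrite -scalerBl mul1r mulN1r.
  congr (_ *: _); case: (lerP (c b) 0) => cb.
    by rewrite max_l ?oppr_ge0 // sub0r opprK.
  by rewrite max_r ?subr0 // oppr_le0 ltW.
have part_obtuse : dotv (part 1) (part (-1)) <= 0.
  rewrite /part dotv_suml big_seq sumr_le0 // => a aB.
  rewrite dotv_sumr big_seq sumr_le0 // => b bB.
  rewrite dotvZl dotvZr mul1r mulN1r; have [<-|ab] := eqVneq a b.
    case: (lerP (c a) 0) => ca; first by rewrite mul0r.
    have -> : Num.max (- c a) 0 = 0 by rewrite max_r // oppr_le0 ltW.
    by rewrite mul0r mulr0.
  rewrite mulrA mulr_ge0_le0 ?obtuse // mulr_ge0 // le_max lexx orbT //.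
have part_nneg s : nneg_comb B (part s).
  by exists (fun b => Num.max (s * c b) 0) => // b; rewrite le_max lexx orbT.
have ge1 s : s = 1 \/ s = -1 -> part s != 0 -> dotv x x <= dotv (part s) (part s).
  move=> s1 p0; have := int_part s s1.
  have : 0 < dotv (part s) (part s) / dotv x x by rewrite divr_gt0 // dotv_gt0.
  move=> q0 /intrP[z qE]; move: q0; rewrite qE ltr0z => z0.
  have : 1 <= dotv (part s) (part s) / dotv x x by rewrite qE ler1z -gtz0_ge1.
  by rewrite ler_pdivlMr // mul1r.
have [p0|p0] := eqVneq (part 1) 0.
  right; rewrite x_part p0 sub0r opprK; exact: part_nneg.
have [q0|q0] := eqVneq (part (-1)) 0.
  left; rewrite x_part q0 subr0; exact: part_nneg.
have := ge1 1 (or_introl erefl) p0; have := ge1 (-1) (or_intror erefl) q0.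
have : dotv x x = dotv (part 1) (part 1) + dotv (part (-1)) (part (-1))
         - 2 * dotv (part 1) (part (-1)).
  rewrite {1 2}x_part !(dotvDl, dotvDr, dotvNl, dotvNr) (dotvC (part (-1)) (part 1)).
  by ring.
move: part_obtuse xgt0; lra.
Qed.


(** Real values are not well-founded, so the measure is the number of entries of [s] with a smaller
    value. *)
Lemma seq_value_ind (s : seq 'cV[R]_l) (f : 'cV[R]_l -> R) (P : 'cV[R]_l -> Prop) :
  {in s, forall x, {in s, forall y, f y < f x -> P y} -> P x} -> {in s, forall x, P x}.
Proof.
move=> IH x; have [n] := ubnP (count (fun z => f z < f x) s).
elim: n x => // n IHn x ltn xs; apply: IH xs _ => y ys yx; apply: IHn => //.
rewrite ltnS in ltn; apply: leq_trans ltn.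
have : (count (fun z => (f z < f y)%R) s + count_mem y s <=
        count (fun z => (f z < f x)%R) s)%N.
  elim: (s) => // z t IHt /=; rewrite addnACA leq_add //.
  have [->|_] := eqVneq z y; first by rewrite ltxx yx.
  by rewrite addn0; case zy: (f z < f y) => //; rewrite (lt_trans zy yx).
by rewrite -has_pred1 has_count in ys; lia.
Qed.

(** * Induction over the positive roots in the span of a base *)

Section RootInduction.

Variable roots : seq 'cV[R]_l.
Hypothesis rootsP : forall x, Phi x -> x \in roots.

Variables (B : seq 'cV[R]_l) (r : 'cV[R]_l).
Hypothesis PB : {in B, forall b, Phi b}.
Hypothesis freeB : free B.
Hypothesis rB : {in B, forall b, 0 < dotv r b}.
Hypothesis simpleB :
  forall x, Phi x -> x \in <<B>>%VS -> nneg_comb B x \/ nneg_comb B (- x).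

Lemma nneg_comb_ge0 x : nneg_comb B x -> 0 <= dotv r x.
Proof.
case=> c c0 ->; rewrite dotv_sumr big_seq sumr_ge0 // => b bB.
by rewrite dotvZr mulr_ge0 // ltW // rB.
Qed.

(** The reflection changes only the coordinate at [b]. If its result were negative, all other
    coordinates of [x] would vanish, making [x] proportional to [b], hence equal to [b]. *)
Lemma simple_reflection_nneg x b : Phi x -> nneg_comb B x -> b \in B -> x != b ->
  nneg_comb B (reflmx b *m x).
Proof.
move=> Px xB bB xb; have Py : Phi (reflmx b *m x) by apply: Phi_refl => //; apply: PB.
have yB : reflmx b *m x \in <<B>>%VS.
  rewrite reflmxE; apply: rpredB; first exact: nneg_comb_span.
  by rewrite memvZ // memv_span.
have [//|[d d0]] := simpleB Py yB; case: xB => c c0 xE; rewrite reflmxE.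
set m := _ / _ => yE.
have sum0 : \sum_(a <- B) (c a + d a - (if a == b then m else 0)) *: a = 0.
  have -> : \sum_(a <- B) (c a + d a - (if a == b then m else 0)) *: a =
     x + \sum_(a <- B) d a *: a - \sum_(a <- B) (if a == b then m else 0) *: a.
    by rewrite xE -big_split -sumrB; apply: eq_bigr => a _; rewrite scalerBl scalerDl.
  have -> : \sum_(a <- B) (if a == b then m else 0) *: a = m *: b.
    rewrite (bigD1_seq b) ?free_uniq //= eqxx big1 ?addr0 // => a /negPf ->.
    by rewrite scale0r.
  by rewrite -yE opprB addrCA subrr addr0 subrr.
have c_eq0 a : a \in B -> a != b -> c a = 0.
  move=> aB ab; have := free_coef0 freeB sum0 aB; rewrite (negPf ab) subr0.
  by move/eqP; rewrite paddr_eq0 // => /andP[/eqP].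
have xcb : x = c b *: b.
  rewrite xE (bigD1_seq b) ?free_uniq //= big_seq_cond big1 ?addr0 //.
  by move=> a /andP[aB ab]; rewrite c_eq0 // scale0r.
have Pb := PB bB.
have [E|E] : c b *: b = b \/ c b *: b = - b.
    by apply: root_proportional; rewrite -?xcb.
  by rewrite xcb E eqxx in xb.
have : (c b + 1) *: b = 0 by rewrite scalerDl scale1r E addNr.
move/eqP; rewrite scaler_eq0 (negPf (Phi_neq0 Pb)) orbF => /eqP cb1.
by have := c0 b; lra.
Qed.

(** Induction on [(r,x)]. As [(x,x) > 0] and [x] is a nonnegative combination of [B], some [b] in
    [B] has [(b,x) > 0]; if [x] is not in [B], reflecting in [b] gives a lower positive root. *)
Lemma simple_root_ind (P : 'cV[R]_l -> Prop) :
  {in B, forall b, P b} ->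
  (forall x b, Phi x -> nneg_comb B x -> b \in B -> x != b -> 0 < dotv b x ->
     nneg_comb B (reflmx b *m x) -> P (reflmx b *m x) -> P x) ->
  forall x, Phi x -> nneg_comb B x -> P x.
Proof.
move=> P_base P_step x Px; have xr := rootsP Px; move: x xr Px.
apply: (@seq_value_ind roots (dotv r)) => x _ IHx Px xB.
have [/P_base //|xnB] := boolP (x \in B).
have [b bB bx] : exists2 b, b \in B & 0 < dotv b x.
  apply: contrapT => nex; have := dotv_gt0 (Phi_neq0 Px); case: (xB) => c c0 xE.
  rewrite {1}xE dotv_suml; apply/negP; rewrite -leNgt big_seq sumr_le0 // => b bB.
  rewrite dotvZl mulr_ge0_le0 // leNgt; apply/negP => bx; apply: nex.
  by exists b.
have xb : x != b by apply: contraNneq xnB => ->.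
have yB := simple_reflection_nneg Px xB bB xb.
have Py : Phi (reflmx b *m x) by apply: Phi_refl => //; apply: PB.
apply: (P_step x b) => //; apply: IHx => //; first exact: rootsP.
rewrite reflmxE dotvDr dotvNr dotvZr gtrBl mulr_gt0 ?rB //.
by rewrite divr_gt0 ?mulr_gt0 ?ltr0n // dotv_gt0 // Phi_neq0 //; apply: PB.
Qed.

End RootInduction.

(** The sum of the coordinate forms, written as an inner product; it is the height function for an
    arbitrary base. *)
Lemma dual_vector B : free B -> exists r, {in B, forall b, dotv r b = 1}.
Proof.
move=> freeB; pose X := in_tuple B.
exists (\col_i \sum_j coord X j (delta_mx i 0)) => b bB.
have coordE j : coord X j b = \sum_i coord X j (delta_mx i 0) * b i 0.
  have {1}-> : b = \sum_i b i 0 *: delta_mx i 0.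
    by rewrite [LHS]matrix_sum_delta; apply: eq_bigr => i _; rewrite big_ord1.
  by rewrite linear_sum; apply: eq_bigr => i _; rewrite linearZ /= mulrC.
rewrite dotvE.
transitivity (\sum_j coord X j b).
  rewrite (eq_bigr _ (fun j _ => coordE j)) exchange_big.
  by apply: eq_bigr => i _; rewrite mxE mulr_suml.
have ltb : (index b B < size B)%N by rewrite index_mem.
rewrite (bigD1 (Ordinal ltb)) //= big1 => [|j jb].
  by rewrite addr0 -{2}(nth_index 0 bB) (coord_free (Ordinal ltb)) // eqxx.
by rewrite -(nth_index 0 bB) (coord_free (Ordinal ltb)) // eq_sym (negPf jb).
Qed.

(** The claim holds for two simple roots by triangularity and the Cartan integers; simple
    reflections extend it first to one arbitrary root ([base1]), then to two ([base2]). *)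
Lemma simple_wall_integral (roots : seq 'cV[R]_l) B :
  (forall x, Phi x -> x \in roots) ->
  crystallographic Phi -> simple_system Phi B -> <<B>>%VS = fullv ->
  wall_triangular B -> wall_integral.
Proof.
move=> rootsP cryst [PB freeB simpleB] fullB tri.
have [r rB] := dual_vector freeB.
have B0 b : b \in B -> dotv b b != 0 by move/PB/Phi_neq0; rewrite dotv_eq0.
have ind (P : 'cV[R]_l -> Prop) : {in B, forall b, P b} ->
    (forall x b, Phi x -> b \in B -> P (reflmx b *m x) -> P x) ->
    (forall x, P x -> P (- x)) -> forall x, Phi x -> P x.
  move=> P_base P_step PN x Px.
  have pos y : Phi y -> nneg_comb B y -> P y.
    apply: (simple_root_ind rootsP PB freeB (r := r)) => //.
    - by move=> b bB; rewrite rB.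
    - by move=> z Pz _; apply: simpleB.
    by move=> z b Pz _ bB _ _ _; apply: P_step.
  have [|Nx] := simpleB x Px; first exact: pos.
  by rewrite -[x]opprK; apply: PN; apply: pos => //; apply: PhiN.
have base : {in B &, forall a b, 2 * wall M a b / dotv a a \is a Num.int /\
                                  2 * wall M a b / dotv b b \is a Num.int}.
  move=> a b aB bB.
  have [int1 int2] : 2 * dotv a b / dotv a a \is a Num.int /\
                     2 * dotv a b / dotv b b \is a Num.int.
    by split; [|rewrite dotvC]; apply: cryst; apply: PB.
  have [-> //|ab] := eqVneq a b; first by rewrite wallxx divff ?B0 ?rpred1.
  have [->|ba0] := eqVneq (wall M a b) 0; first by rewrite mulr0 !mul0r rpred0.
  (* For [a != b] the order in [B] makes one of the two values vanish, and the other is then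
     [(a,b)]. *)
  suff ab0 : wall M b a = 0 by rewrite -symM ab0 addr0 in int1 int2.
  apply/eqP; apply: contraNT ba0 => ba0.
  elim: (B) tri aB bB => // c C IHC /andP[/allP triC tri].
  rewrite !inE => /orP[/eqP ac|aC] /orP[/eqP bc|bC].
  - by rewrite ac bc eqxx in ab.
  - by have := triC _ bC; rewrite -ac (negPf ba0).
  - by have := triC _ aC; rewrite -bc.
  - exact: IHC.
have base1 a : a \in B -> forall x, Phi x ->
    2 * wall M x a / dotv a a \is a Num.int /\ 2 * wall M a x / dotv a a \is a Num.int.
  move=> aB; apply: ind => [b bB|x b Px bB [int1 int2]|x].
  - by split; [apply: (base b a _ _).2|apply: (base a b _ _).1].
  - have int_m : 2 * dotv b x / dotv b b \is a Num.int by apply: cryst => //; apply: PB.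
    have [int3 _] := base a b aB bB; have [_ int4] := base b a bB aB.
    move: int1 int2; rewrite reflmxE; set m := _ / _ in int_m *.
    rewrite wallDl wallDr wallNl wallNr wallZl wallZr => int1 int2.
    have -> : 2 * wall M x a / dotv a a = 2 * (wall M x a - m * wall M b a) / dotv a a
        + m * (2 * wall M b a / dotv a a) by field; rewrite B0.
    have -> : 2 * wall M a x / dotv a a = 2 * (wall M a x - m * wall M a b) / dotv a a
        + m * (2 * wall M a b / dotv a a) by field; rewrite B0.
    by rewrite !rpredD // rpredM.
  - by rewrite wallNl wallNr !mulrN !mulNr !rpredN.
(* Treating both argument orders at once lets a single denominator [(y,y)] suffice; exchanging the
   roles of [x] and [y] gives the other one. *)
suff base2 y : Phi y -> forall x, Phi x ->
    2 * wall M x y / dotv y y \is a Num.int /\ 2 * wall M y x / dotv y y \is a Num.int.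
  by move=> x y Px Py; split; [apply: (base2 x Px y Py).2|apply: (base2 y Py x Px).1].
move: y; apply: ind => [b bB|y b Py bB IHy x Px|y IHy x /IHy].
- exact: base1.
- have := IHy x Px; have [int3 int4] := base1 b bB x Px.
  have y0 : dotv y y != 0 by rewrite dotv_eq0 Phi_neq0.
  have int_m : 2 * dotv y b / dotv y y \is a Num.int by apply: cryst => //; apply: PB.
  (* Reflections preserve lengths. In the correction terms below, the denominators [(b,b)] and
     [(y,y)] are exchanged, leaving a Cartan integer times a value known from [base1]. *)
  have -> : dotv (reflmx b *m y) (reflmx b *m y) = dotv y y.
    rewrite reflmxE !(dotvDl, dotvDr, dotvNl, dotvNr, dotvZl, dotvZr) (dotvC y b).
    by field; rewrite B0.
  rewrite reflmxE wallDl wallDr wallNl wallNr wallZl wallZr => -[int1 int2].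
  have -> : 2 * wall M x y / dotv y y =
     2 * (wall M x y - 2 * dotv b y / dotv b b * wall M x b) / dotv y y
     + (2 * dotv y b / dotv y y) * (2 * wall M x b / dotv b b).
    by rewrite (dotvC y b); field; rewrite B0 // y0.
  have -> : 2 * wall M y x / dotv y y =
     2 * (wall M y x - 2 * dotv b y / dotv b b * wall M b x) / dotv y y
     + (2 * dotv y b / dotv y y) * (2 * wall M b x / dotv b b).
    by rewrite (dotvC y b); field; rewrite B0 // y0.
  by rewrite !rpredD // rpredM.
by rewrite wallNl wallNr dotvNl dotvNr opprK !mulrN !mulNr !rpredN.
Qed.

End RootSet.

End WallForm.

(** * Reflection groups *)

Section ReflectionGroup.

Set Implicit Arguments.
Unset Strict Implicit.
Unset Printing Implicit Defensive.

Import Order.TTheory GRing.Theory Num.Theory.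
Local Open Scope ring_scope.

Variables (R : realType) (l : nat) (W : finGroupType).
Variable rW : mx_representation R [set: W] l.
Hypothesis hW : reflection_group rW.

Local Notation T := (reflections rW).
Local Notation rp B := (\big[mulmx/1%:M]_(b <- B) reflmx b).

Lemma reprM (x y : W) : rW (x * y)%g = rW x *m rW y.
Proof. by rewrite repr_mxM ?inE. Qed.

Lemma repr_inj : injective rW.
Proof. by case: hW => f _ _ x y; apply: (mx_faithful_inj f); rewrite inE. Qed.

Lemma repr_trmxV (x : W) : (rW x)^T = rW x^-1%g.
Proof.
case: hW => _ orth _; have xV : rW x *m rW x^-1%g = 1%:M.
  by rewrite -reprM mulgV repr_mx1.
by rewrite -[LHS]mulmx1 -xV mulmxA orth mul1mx.
Qed.

Lemma reflectionsP (t : W) :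
  t \in T <-> exists2 a : 'cV[R]_l, a != 0 & rW t = reflmx a.
Proof. by rewrite inE; split => [/asboolP|?]; last apply/asboolP. Qed.

Lemma repr_conj_reflmx (t w : W) (a : 'cV[R]_l) :
  rW t = reflmx a -> rW (t ^ w)%g = reflmx (rW w^-1%g *m a).
Proof.
case: hW => _ orth _ ta.
rewrite conjgE !reprM ta reflmxJ ?orth // ?repr_trmxV ?invgK ?mulmxA //.
by rewrite -reprM mulVg repr_mx1.
Qed.

Lemma reflections_conj (t w : W) : t \in T -> (t ^ w)%g \in T.
Proof.
move/reflectionsP => [a a0 ta]; apply/reflectionsP.
exists (rW w^-1%g *m a); last exact: repr_conj_reflmx.
apply: contraNneq a0 => E; rewrite -[a]mul1mx -(repr_mx1 rW) -(mulgV w) reprM.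
by rewrite -mulmxA E mulmx0.
Qed.

Lemma reflections_invol (t : W) : t \in T -> (t * t = 1)%g.
Proof.
move/reflectionsP => [a a0 ta]; apply: repr_inj.
by rewrite reprM repr_mx1 ta reflmxK.
Qed.

Lemma reflections1 : 1%g \notin T.
Proof.
apply/negP => /reflectionsP[a a0 /eqP].
by rewrite repr_mx1 eq_sym (negPf (reflmx_neq1 a0)).
Qed.

Lemma reflections_gen : <<T>>%g = [set: W].
Proof. by case: hW. Qed.

Let redE := reduced_cons reflections_gen reflections_invol reflections1.

Variables Phi PhiP : set 'cV[R]_l.
Hypothesis hPhi : root_system rW Phi.

Lemma root_neq0 (a : 'cV[R]_l) : Phi a -> a != 0.
Proof. by case: hPhi => h _ _ _ _ /h[]. Qed.

Lemma root_reflmx (a b : 'cV[R]_l) : Phi a -> Phi b -> Phi (reflmx a *m b).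
Proof. by case: hPhi => h1 _ _ _ h5 /h1[_ [t <-]]; apply: h5. Qed.

Lemma root_inj (a b : 'cV[R]_l) :
  Phi a -> Phi b -> reflmx a = reflmx b -> b = a \/ b = - a.
Proof. by case: hPhi => _ _ _ h4 _; apply: h4. Qed.

Lemma root_opp (a : 'cV[R]_l) : Phi a -> Phi (- a).
Proof. by case: hPhi => _ _ h _ _; apply: h. Qed.

Lemma root_reflP (a : 'cV[R]_l) : Phi a ->
  root_refl rW a \in T /\ rW (root_refl rW a) = reflmx a.
Proof.
move=> Pa; have a0 := root_neq0 Pa; case: hPhi => /(_ a Pa)[_ [t ta]] _ _ _ _.
have E : rW (root_refl rW a) = reflmx a.
  by rewrite /root_refl; case: pickP => [s /eqP //|/(_ t)]; rewrite ta eqxx.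
by split=> //; apply/reflectionsP; exists a.
Qed.

Variable r : 'cV[R]_l.
Hypothesis r_neq0 : forall a, Phi a -> dotv r a != 0.
Hypothesis PhiPE : forall a, PhiP a <-> Phi a /\ 0 < dotv r a.

Lemma positive_root_exists : exists pr : W -> 'cV[R]_l,
  {in T, forall t, PhiP (pr t) /\ rW t = reflmx (pr t)}.
Proof.
suff ex t : exists a : 'cV[R]_l, t \in T -> PhiP a /\ rW t = reflmx a.
  by have [pr prP] := choice ex; exists pr => t; apply: prP.
have [Tt|] := boolP (t \in T); last by exists 0.
case: hPhi => _ /(_ t Tt)[a Pa ta] _ _ _.
have [ra|ra] := ltP 0 (dotv r a).
  by exists a => _; split=> //; apply/PhiPE.
exists (- a) => _; rewrite reflmxN; split=> //; apply/PhiPE.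
by split; [apply: root_opp|rewrite dotvNr oppr_gt0 lt_neqAle r_neq0].
Qed.

Variable pr : W -> 'cV[R]_l.
Hypothesis prP : {in T, forall t, PhiP (pr t) /\ rW t = reflmx (pr t)}.

Lemma pr_root (t : W) : t \in T -> Phi (pr t).
Proof. by move/prP=> [/PhiPE[]]. Qed.

Lemma pr_pos (t : W) : t \in T -> 0 < dotv r (pr t).
Proof. by move/prP=> [/PhiPE[]]. Qed.

Lemma pr_reflmx (t : W) : t \in T -> rW t = reflmx (pr t).
Proof. by move/prP=> []. Qed.

Lemma pr_of_root (t : W) (a : 'cV[R]_l) : t \in T -> Phi a -> rW t = reflmx a ->
  pr t = a \/ pr t = - a.
Proof.
by move=> Tt Pa ta; apply: root_inj (pr_root Tt) _ => //; rewrite -ta pr_reflmx.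
Qed.

(** The absolute value absorbs the unknown sign of a root obtained by conjugation. *)
Lemma dotv_pr_of_root (t : W) (a : 'cV[R]_l) : t \in T -> Phi a -> rW t = reflmx a ->
  dotv r (pr t) = `|dotv r a|.
Proof.
move=> Tt Pa ta; rewrite -[LHS]gtr0_norm ?pr_pos //.
by case: (pr_of_root Tt Pa ta) => ->; rewrite // dotvNr normrN.
Qed.

Lemma root_refl_pr (t : W) : t \in T -> root_refl rW (pr t) = t.
Proof.
move=> Tt; apply: repr_inj; rewrite (root_reflP (pr_root Tt)).2.
by rewrite pr_reflmx.
Qed.

Lemma pr_inj : {in T &, injective pr}.
Proof. by move=> s t Ts Tt E; rewrite -(root_refl_pr Ts) E root_refl_pr. Qed.

(** An enumeration of the root system, as required by the induction over roots. *)
Definition all_roots : seq 'cV[R]_l :=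
  [seq pr t | t <- enum T] ++ [seq - pr t | t <- enum T].

Lemma all_rootsP (a : 'cV[R]_l) : Phi a -> a \in all_roots.
Proof.
move=> Pa; have [Ta Ea] := root_reflP Pa; rewrite mem_cat.
have memT : root_refl rW a \in enum T by rewrite mem_enum.
case: (pr_of_root Ta Pa Ea) => E; first by rewrite -{1}E map_f.
by rewrite -{2}[a]opprK -E (map_f (fun t => - pr t)) // orbT.
Qed.

Lemma repr_prod (ts : seq W) : all (mem T) ts ->
  rW (\prod_(t <- ts) t)%g = rp (map pr ts).
Proof.
elim: ts => [|t ts IHts] /=; first by rewrite !big_nil repr_mx1.
by case/andP=> Tt Tts; rewrite !big_cons reprM IHts // pr_reflmx.
Qed.

(** * The first reflection in a reflection ordering *)

Section ReflectionOrder.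

Variable lt : rel W.
Hypothesis hlt : reflection_ordering rW PhiP lt.

Lemma lt_asym (s t : W) : s \in T -> t \in T -> lt s t -> lt t s -> False.
Proof.
have [[irr tr _] _] := hlt => Ts Tt st ts.
by have := irr s Ts; rewrite (tr t s s).
Qed.

Lemma lt_irr (t : W) : t \in T -> lt t t -> False.
Proof. by move=> Tt h; apply: (@lt_asym t t). Qed.

(* Moving from a root [x] to [s_b x = x - m b] with [b] simple keeps [t_x]
   between [t_b] and the reflection of the lower root. *)
Lemma first_simple_reflection (t : W) (ts : seq W) (t' : W) :
  all (mem T) (t :: ts) -> sorted lt (t :: ts) -> free (map pr (t :: ts)) ->
  (forall x, Phi x -> x \in <<map pr (t :: ts)>>%VS ->
     nneg_comb (map pr (t :: ts)) x \/ nneg_comb (map pr (t :: ts)) (- x)) ->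
  t' \in T -> pr t' \in <<map pr (t :: ts)>>%VS -> (t == t') || lt t t'.
Proof.
have [[irr tr _] conv] := hlt; set B := map pr (t :: ts).
move=> Tts srt freeB simpleB Tt' t'B.
have [Tt _] := andP Tts.
have PB : {in B, forall b, Phi b}.
  by move=> _ /mapP[s sts ->]; apply: pr_root; apply: (allP Tts).
have rB : {in B, forall b, 0 < dotv r b}.
  by move=> _ /mapP[s sts ->]; apply: pr_pos; apply: (allP Tts).
have pos x : Phi x -> nneg_comb B x -> PhiP x.
  move=> Px xB; apply/PhiPE; split=> //.
  by rewrite lt_neqAle eq_sym r_neq0 // (nneg_comb_ge0 rB).
have nneg_t' : nneg_comb B (pr t').
  have [//|/(nneg_comb_ge0 rB)] := simpleB _ (pr_root Tt') t'B.
  by rewrite dotvNr oppr_ge0 leNgt pr_pos.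
have base b : b \in B -> (t == root_refl rW b) || lt t (root_refl rW b).
  case/mapP => s sts ->; have Ts : s \in T by apply: (allP Tts).
  rewrite root_refl_pr //; move: sts; rewrite inE => /orP[/eqP ->|sts].
    by rewrite eqxx.
  by rewrite (allP (order_path_min_in tr Tts srt) s sts) orbT.
suff : (t == root_refl rW (pr t')) || lt t (root_refl rW (pr t')).
  by rewrite root_refl_pr.
move: (pr t') (pr_root Tt') nneg_t' => x Px xB.
apply: (simple_root_ind root_neq0 root_inj root_reflmx all_rootsP PB freeB rB simpleB
  (P := fun x => is_true ((t == root_refl rW x) || lt t (root_refl rW x)))) Px xB => //.
move=> {}x b Px xB bB xb bx; set y := reflmx b *m x => yB t_y.
have Pb := PB b bB; have Py : Phi y by apply: root_reflmx.
have m0 : 0 < 2 * dotv b x / dotv b b.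
  by rewrite divr_gt0 ?mulr_gt0 ?ltr0n // dotv_gt0 // root_neq0.
have xE : x = (2 * dotv b x / dotv b b) *: b + 1 *: y.
  by rewrite scale1r /y reflmxE addrC subrK.
have [Tb Tx Ty] : [/\ root_refl rW b \in T, root_refl rW x \in T & root_refl rW y \in T].
  by split; apply: (root_reflP _).1.
have x_b_y : b != y.
  apply: contraNneq xb => by_.
  have xk : x = (2 * dotv b x / dotv b b + 1) *: b by rewrite {1}xE -by_ -scalerDl.
  have [E|E] : (2 * dotv b x / dotv b b + 1) *: b = b \/
               (2 * dotv b x / dotv b b + 1) *: b = - b.
      by apply: (root_proportional root_neq0 root_inj) => //; rewrite -xk.
    by rewrite {1}xk E.
  have /PhiPE[_] := pos _ Px xB; rewrite {1}xk E dotvNr oppr_gt0 => h1.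
  by have := lt_trans h1 (rB b bB); rewrite ltxx.
have xy : x != y.
  apply/eqP => E; move: bx; rewrite /y reflmxE in E.
  move/eqP: E; rewrite -subr_eq0 opprB addrC subrK scaler_eq0 gt_eqF //=.
  by rewrite (negPf (root_neq0 Pb)).
have [[bx' _]|[yx _]] := conv x b y (pos _ Px xB) ((PhiPE b).2 (conj Pb (rB b bB)))
    (pos _ Py yB) xb xy x_b_y (ex_intro _ _ (ex_intro _ _ (And3 m0 ltr01 xE))).
  case/orP: (base b bB) => [/eqP ->|t_b]; first by rewrite bx' orbT.
  by rewrite (tr _ _ _ Tb Tt Tx t_b bx') orbT.
case/orP: t_y => [/eqP ->|t_y]; first by rewrite yx orbT.
by rewrite (tr _ _ _ Ty Tt Tx t_y yx) orbT.
Qed.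

End ReflectionOrder.

(** * Factorisations below a Coxeter element *)

Section CoxeterElement.

Variables (g : W) (D : seq 'cV[R]_l).
Hypothesis hD : simple_system Phi D.
Hypothesis fullD : <<D>>%VS = fullv.
Hypothesis gE : g = (\prod_(a <- D) root_refl rW a)%g.

Local Notation M := (invmx (1%:M - rW g)).

Lemma rp_simple : rp D = rW g.
Proof.
case: hD => PD _ _; rewrite gE; elim: D PD => [|a s IHs] PD.
  by rewrite !big_nil repr_mx1.
rewrite !big_cons reprM (root_reflP (PD a (mem_head _ _))).2 IHs // => b bs.
by apply: PD; rewrite inE bs orbT.
Qed.

(** A vector fixed by [g] is orthogonal to the simple roots, which span the space, hence to
    itself. *)
Lemma coxeter_unit : 1%:M - rW g \in unitmx.
Proof.
case: hD => _ freeD _; apply: unitmx_ker => x.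
rewrite mulmxBl mul1mx => /eqP; rewrite subr_eq0 eq_sym => /eqP gx.
rewrite -rp_simple in gx; have orth := rp_fixed_orthogonal freeD gx.
have : x \in <<D>>%VS by rewrite fullD memvf.
case/(span_coef (free_uniq freeD)) => c xE; apply/eqP; rewrite -dotv_eq0 {1}xE.
rewrite dotv_suml big_seq big1 // => b bD; by rewrite dotvZl orth ?mulr0.
Qed.

Lemma coxeter_symm (x y : 'cV[R]_l) : wall M x y + wall M y x = dotv x y.
Proof.
by apply: (wall_symm coxeter_unit) => //; case: hW => _ /(_ g).
Qed.

Lemma size_simple : size D = \dim {: 'cV[R]_l}.
Proof. by case: hD => _ /eqP <- _; rewrite fullD. Qed.

Lemma coxeter_length : (abs_length T g <= \dim {: 'cV[R]_l})%N.
Proof.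
case: hD => PD _ _; rewrite -size_simple gE -(size_map (root_refl rW)).
rewrite -(big_map (root_refl rW) xpredT id).
apply: (abs_length_prod reflections_gen); apply/allP => _ /mapP[a aD ->].
by apply: (root_reflP _).1; apply: PD.
Qed.

(** The roots of a factorisation of [g] span the space, and a reduced one has no more letters than
    the dimension, so its roots form a basis. *)
Lemma reduced_coxeter (ts : seq W) : reduced T g ts ->
  rp (map pr ts) = rW g /\ free (map pr ts).
Proof.
case/and3P => Tts /eqP pts /eqP szts.
have rpts : rp (map pr ts) = rW g by rewrite -repr_prod // pts.
split=> //; rewrite /free (full_span coxeter_unit erefl rpts) eqn_leq.
rewrite {2}size_map szts coxeter_length andbT.
by rewrite -(full_span coxeter_unit erefl rpts) dim_span.
Qed.

(** A reduced word of [w] is a prefix of one of [g], and both properties pass to prefixes. *)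
Lemma NC_reduced (w : W) (ts : seq W) : w \in NC T g -> reduced T w ts ->
  free (map pr ts) /\ wall_triangular M (map pr ts).
Proof.
move=> NCw /(reduced_NC_cat reflections_gen NCw)[us /reduced_coxeter[rpB freeB]].
have := wall_triangular_cat coxeter_unit erefl (B1 := [::]) freeB rpB.
move: freeB; rewrite map_cat => /catl_free -> /=.
by rewrite /wall_triangular pairwise_cat => /and3P[].
Qed.

(** By [wall_reflection_prefix] the root of [t] is in the image of [1 - w], which lies in the span
    of the roots of any factorisation of [w]. *)
Lemma NC_span (w t : W) (ts ts' : seq W) : w \in NC T g ->
  reduced T w ts -> reduced T w (t :: ts') -> pr t \in <<map pr ts>>%VS.
Proof.
move=> NCw redw redw'; have [us] := reduced_NC_cat reflections_gen NCw redw'.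
case/reduced_coxeter; rewrite map_cat => rpB freeB.
have := wall_reflection_prefix coxeter_unit erefl freeB rpB coxeter_symm.
rewrite -/(map pr (t :: ts')) -repr_prod; last by case/and3P: redw'.
have /and3P[_ /eqP -> _] := redw'; have /and3P[Tts /eqP <- _] := redw.
by rewrite repr_prod // => E; rewrite -E; apply: sub_rp_span.
Qed.

Lemma reduced_hurwitz (x y : W) : reduced T (x * y)%g [:: x; y] ->
  reduced T (x * y)%g [:: y; (x ^ y)%g] /\ reduced T (x * y)%g [:: (y ^ x^-1)%g; x].
Proof.
move=> red; have /and3P[/and3P[Tx Ty _] _ /eqP sz] := red.
rewrite /reduced -sz /= (Tx : x \in T) (Ty : y \in T).
rewrite !reflections_conj //= !big_cons !big_nil !mulg1 !conjgE invgK.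
by rewrite mulKVg !mulgA mulgVK !eqxx.
Qed.

Variable lt : rel W.
Hypothesis hlt : reflection_ordering rW PhiP lt.
Hypothesis hcomp : compatible rW Phi PhiP g lt.
Hypothesis cryst : crystallographic Phi.

Lemma coxeter_integral : wall_integral M Phi.
Proof.
case: (hD) => _ freeD _.
apply: (simple_wall_integral root_neq0 root_opp root_inj root_reflmx coxeter_symm
  all_rootsP cryst hD fullD).
by apply: (wall_triangular_cat coxeter_unit erefl (B1 := [::]) freeD rp_simple).
Qed.

Lemma NC_obtuse_simple (w : W) (ts : seq W) : w \in NC T g -> reduced T w ts ->
  {in map pr ts &, forall a b, a != b -> dotv a b <= 0} ->
  forall x, Phi x -> x \in <<map pr ts>>%VS ->
    nneg_comb (map pr ts) x \/ nneg_comb (map pr ts) (- x).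
Proof.
move=> NCw redw obtuse x Px xB; have [freeB tri] := NC_reduced NCw redw.
apply: (obtuse_simple root_neq0 coxeter_symm coxeter_integral _ freeB tri obtuse Px xB).
move=> _ /mapP[t tts ->]; apply: pr_root; case/and3P: redw => Tts _ _.
exact: (allP Tts).
Qed.

Lemma reduced_pairP (x y : W) : reduced T (x * y)%g [:: x; y] -> x \in T /\ y \in T.
Proof. by case/and3P => /and3P[]. Qed.

Lemma obtuse_pair (px py : 'cV[R]_l) : dotv px py <= 0 ->
  {in [:: px; py] &, forall a b, a != b -> dotv a b <= 0}.
Proof.
move=> le0 a b; rewrite !inE => /orP[]/eqP -> /orP[]/eqP ->; rewrite ?eqxx //.
by rewrite dotvC.
Qed.

Lemma wall_pair (x y : W) : (x * y)%g \in NC T g -> reduced T (x * y)%g [:: x; y] ->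
  wall M (pr y) (pr x) = 0.
Proof.
move=> NCxy red; have [_] := NC_reduced NCxy red.
by rewrite /wall_triangular /= !andbT => /eqP.
Qed.

Lemma cauchy_schwarz_strict (x y : 'cV[R]_l) : free [:: x; y] ->
  dotv x y ^+ 2 < dotv x x * dotv y y.
Proof.
rewrite free_cons seq1_free span_seq1 => /andP[xy y0].
have yy := dotv_gt0 y0; pose z := dotv y y *: x - dotv x y *: y.
have z0 : z != 0.
  apply: contraNneq xy => /eqP; rewrite subr_eq0 => /eqP E.
  have -> : x = (dotv y y)^-1 *: (dotv x y *: y).
    by rewrite -E scalerA mulVf ?scale1r // gt_eqF.
  by rewrite !memvZ // memv_line.
have := dotv_gt0 z0.
have -> : dotv z z = dotv y y * (dotv x x * dotv y y - dotv x y ^+ 2).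
  rewrite /z !(dotvDl, dotvDr, dotvNl, dotvNr, dotvZl, dotvZr) (dotvC y x); ring.
by rewrite pmulr_rgt0 // subr_gt0.
Qed.

(* Among the factorisations [x y] of a fixed [w <= g] the one minimising
   [(r, pr x) + (r, pr y)] is obtuse: otherwise both Hurwitz moves increase the
   sum, forcing [4 (x,y)^2 >= 4 (x,x)(y,y)]. *)
Lemma exists_obtuse_pair (a b : W) :
  (a * b)%g \in NC T g -> reduced T (a * b)%g [:: a; b] ->
  exists x y : W, [/\ (x * y = a * b)%g, reduced T (x * y)%g [:: x; y] &
    dotv (pr x) (pr y) <= 0].
Proof.
move=> NCab red.
pose P := [pred p : W * W | reduced T (a * b)%g [:: p.1; p.2]].
pose F (p : W * W) := dotv r (pr p.1) + dotv r (pr p.2).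
case: (@arg_minP _ _ _ (a, b) P F red) => -[x y] /= redxy minF.
have xyE : (x * y = a * b)%g.
  by case/and3P: redxy => _ /eqP <- _; rewrite big_cons big_seq1.
exists x, y; rewrite xyE; split=> //; rewrite leNgt; apply/negP => xy_gt0.
rewrite -xyE in redxy NCab minF *; have [Tx Ty] := reduced_pairP redxy.
have [red1 red2] := reduced_hurwitz redxy.
have [freexy _] := NC_reduced NCab redxy; have cs := cauchy_schwarz_strict freexy.
have [px py] := (dotv_gt0 (root_neq0 (pr_root Tx)), dotv_gt0 (root_neq0 (pr_root Ty))).
have [rx ry] := (pr_pos Tx, pr_pos Ty).
have F1 := minF (y, (x ^ y)%g); rewrite /P /F /= red1 in F1; have {F1} := F1 isT.
have F2 := minF ((y ^ x^-1)%g, x); rewrite /P /F /= red2 in F2; have {F2} := F2 isT.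
rewrite (@dotv_pr_of_root (y ^ x^-1)%g (reflmx (pr x) *m pr y)); first last.
- by rewrite (repr_conj_reflmx _ (pr_reflmx Ty)) invgK pr_reflmx.
- by apply: root_reflmx; apply: pr_root.
- exact: reflections_conj.
rewrite (@dotv_pr_of_root (x ^ y)%g (reflmx (pr y) *m pr x)); first last.
- by rewrite (repr_conj_reflmx _ (pr_reflmx Tx)) (invg_T reflections_invol Ty) pr_reflmx.
- by apply: root_reflmx; apply: pr_root.
- exact: reflections_conj.
rewrite !reflmxE !dotvDr !dotvNr !dotvZr (dotvC (pr y) (pr x)).
move: (dotv (pr x) (pr y)) xy_gt0 cs => c c0 cs.
set X := dotv r _ in rx *; set Y := dotv r _ in ry *.
move: (dotv (pr x) (pr x)) (dotv (pr y) (pr y)) px py cs => A B A0 B0 cs.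
have m0 : 0 < 2 * c / A by rewrite divr_gt0 // mulr_gt0 // ltr0n.
have n0 : 0 < 2 * c / B by rewrite divr_gt0 // mulr_gt0 // ltr0n.
have mn4 : (2 * c / A) * (2 * c / B) < 4.
  have -> : (2 * c / A) * (2 * c / B) = 4 * (c ^+ 2 / (A * B)).
    by field; rewrite !gt_eqF.
  by rewrite gtr_pMr ?ltr0n // ltr_pdivrMr ?mulr_gt0 // mul1r.
move: (2 * c / A) (2 * c / B) m0 n0 mn4 => m n m0 n0 mn4 F2 F1.
(* Minimality says that [|Y - m X|] is at least [Y], and [m X > 0] leaves only the case where
   [Y - m X] is negative. *)
have mX : 2 * Y <= m * X.
  have mX0 : 0 < m * X by rewrite mulr_gt0.
  by move: F2; case: (ger0P (Y - m * X)) => ?; lra.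
have nY : 2 * X <= n * Y.
  have nY0 : 0 < n * Y by rewrite mulr_gt0.
  by move: F1; case: (ger0P (X - n * Y)) => ?; lra.
have : (2 * Y) * (2 * X) <= (m * X) * (n * Y).
  by rewrite ler_pM // mulr_ge0 // ltW.
have XY : 0 < X * Y by rewrite mulr_gt0.
have -> : (2 * Y) * (2 * X) = 4 * (X * Y) by ring.
have -> : (m * X) * (n * Y) = (m * n) * (X * Y) by ring.
by rewrite ler_pM2r // leNgt mn4.
Qed.

(** [NC_span] concerns first letters; a Hurwitz move brings [b] to the front. *)
Lemma reduced_pair_span (w a b x y : W) : w \in NC T g ->
  (a * b)%g = w -> (x * y)%g = w -> reduced T w [:: a; b] -> reduced T w [:: x; y] ->
  pr a \in <<[:: pr x; pr y]>>%VS /\ pr b \in <<[:: pr x; pr y]>>%VS.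
Proof.
move=> NCw ab xy redab redxy; split; first exact: (NC_span NCw redxy redab).
rewrite -ab in redab redxy NCw; have [red _] := reduced_hurwitz redab.
exact: (NC_span NCw redxy red).
Qed.

(** In an orthogonal splitting the non-orthogonal roots [pa] and [pb] fall in the same part. A root
    of the other part would be orthogonal to the whole plane, yet lie in it. *)
Lemma irreducible_span2 (px py pa pb : 'cV[R]_l) :
  Phi pa -> Phi pb -> pa != pb -> 0 < dotv pa pb ->
  pa \in <<[:: px; py]>>%VS -> pb \in <<[:: px; py]>>%VS ->
  px \in <<[:: pa; pb]>>%VS -> py \in <<[:: pa; pb]>>%VS ->
  irreducible_roots (fun v => Phi v /\ v \in <<[:: px; py]>>%VS).
Proof.
move=> Pa Pb ab dab a_in b_in x_in y_in; split; first by exists pa.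
case=> A [B [[a0 Aa0] [b0 Bb0] cover orth]].
have sub : (<<[:: px; py]>> <= <<[:: pa; pb]>>)%VS.
  by apply/span_subvP => v; rewrite !inE => /orP[]/eqP ->.
have no_split (C : set 'cV[R]_l) c : C c -> (forall v, C v -> Phi v /\ v \in <<[:: px; py]>>%VS) ->
    (forall v, C v -> dotv pa v = 0 /\ dotv pb v = 0) -> False.
  move=> Cc CPhi Corth; have [Pc /(subvP sub) c_in] := CPhi c Cc.
  have [|k cE] := span_coef _ c_in; first by rewrite /= inE ab.
  have [ca cb] := Corth c Cc; have := root_neq0 Pc; rewrite -dotv_eq0 {1}cE.
  by rewrite !big_cons big_nil addr0 dotvDl !dotvZl ca cb !mulr0 addr0 eqxx.
have same C C' : (forall v, Phi v /\ v \in <<[:: px; py]>>%VS <-> C v \/ C' v) ->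
    (forall u v, C u -> C' v -> dotv u v = 0) -> C pa -> C pb.
  move=> cov orthC Ca; have [//|C'b] := (cov pb).1 (conj Pb b_in).
  by move: dab; rewrite (orthC _ _ Ca C'b) ltxx.
have cover' v : Phi v /\ v \in <<[:: px; py]>>%VS <-> B v \/ A v.
  by split=> [/cover[]|[h|h]]; [right|left|apply/cover; right|apply/cover; left].
have orth' u v : B u -> A v -> dotv u v = 0 by move=> Bu Av; rewrite dotvC orth.
have [Aa|Ba] := (cover pa).1 (conj Pa a_in).
  apply: (no_split B b0 Bb0) => [v Bv|v Bv]; first by apply/cover; right.
  by have Ab := same A B cover orth Aa; split; apply: orth.
apply: (no_split A a0 Aa0) => [v Av|v Av]; first by apply/cover; left.
by have Bb := same B A cover' orth' Ba; split; apply: orth'.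
Qed.

(* With [x], [y] the simple pair of the plane of [pr a], [pr b], the
   antisymmetric part of the wall form gives [(a,b) = det (x,y)], where [det] is
   the determinant of [a], [b] in the basis [x], [y]; the reflection ordering
   makes [det] nonnegative. *)
Lemma rising_pair_obtuse (a b : W) :
  (a * b)%g \in NC T g -> reduced T (a * b)%g [:: a; b] -> lt a b ->
  dotv (pr a) (pr b) <= 0.
Proof.
move=> NCab redab ltab; rewrite leNgt; apply/negP => dab.
have [x [y [xyE redxy dxy]]] := exists_obtuse_pair NCab redab.
have NCxy : (x * y)%g \in NC T g by rewrite xyE.
have [Ta Tb] := reduced_pairP redab; have [Tx Ty] := reduced_pairP redxy.
have redxy' : reduced T (a * b)%g [:: x; y] by rewrite -xyE.
have redab' : reduced T (x * y)%g [:: a; b] by rewrite xyE.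
have [a_in b_in] := reduced_pair_span NCab erefl xyE redab redxy'.
have [x_in y_in] := reduced_pair_span NCab xyE erefl redxy' redab.
have [freexy _] := NC_reduced NCxy redxy.
have simple_xy := NC_obtuse_simple NCxy redxy (obtuse_pair dxy).
have ab : a != b by apply/eqP => E; apply: (lt_irr hlt Ta); rewrite {2}E.
have irr := irreducible_span2 (pr_root Ta) (pr_root Tb) _ dab a_in b_in x_in y_in.
have xy : pr x != pr y by have := free_uniq freexy; rewrite /= inE andbT.
(* The obtuse pair is simple for its plane, which is irreducible since it is spanned by the
   non-orthogonal roots of [a] and [b], so compatibility applies. *)
have ltxy : lt x y.
  rewrite -(root_refl_pr Tx) -(root_refl_pr Ty).
  apply: (hcomp (Psi := fun v => Phi v /\ v \in <<[:: pr x; pr y]>>%VS)).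
  - by exists (pr x), (pr y); split=> //; apply: pr_root.
  - by apply: irr; rewrite (inj_in_eq pr_inj).
  - split=> //; last by move=> v [Pv v_in]; apply: simple_xy.
    move=> v; rewrite !inE => /orP[]/eqP ->; split; try exact: pr_root.
      by rewrite memv_span // mem_head.
    by rewrite memv_span // !inE eqxx orbT.
  - by case: (prP Tx).
  - by case: (prP Ty).
  by rewrite !root_refl_pr.
have x_first t : t \in T -> pr t \in <<[:: pr x; pr y]>>%VS -> (x == t) || lt x t.
  by apply: (first_simple_reflection hlt (ts := [:: y])) => //=; rewrite ?Tx ?Ty ?ltxy.
have xb : b != x.
  apply/eqP => E; rewrite E in ltab Tb; case/orP: (x_first a Ta a_in) => [/eqP xa|].
    by apply: (lt_irr hlt Ta); rewrite -{2}xa.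
  exact (lt_asym hlt Ta Tb ltab).
have xa : a != x.
  apply/eqP => E; move: dab; rewrite ltNge; move: dxy; rewrite -E.
  have -> : y = b by apply: (mulgI x); rewrite xyE E.
  by move=> ->.
have rB : {in [:: pr x; pr y], forall v, 0 < dotv r v}.
  by move=> v; rewrite !inE => /orP[]/eqP ->; apply: pr_pos.
have comb t : t \in T -> pr t \in <<[:: pr x; pr y]>>%VS ->
    exists c1 c2, [/\ 0 <= c1, 0 <= c2 & pr t = c1 *: pr x + c2 *: pr y].
  move=> Tt t_in; have [|[c c0 tE]|] := simple_xy (pr t) (pr_root Tt) => //.
    by exists (c (pr x)), (c (pr y)); split=> //; rewrite tE !big_cons big_nil addr0.
  by move/(nneg_comb_ge0 rB); rewrite dotvNr oppr_ge0 leNgt pr_pos.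
have [c1 [c2 [c10 c20 aE]]] := comb a Ta a_in.
have [d1 [d2 [d10 d20 bE]]] := comb b Tb b_in.
have dabE : dotv (pr a) (pr b) = (c1 * d2 - c2 * d1) * dotv (pr x) (pr y).
  have wba := wall_pair NCab redab; have wyx := wall_pair NCxy redxy.
  rewrite -coxeter_symm wba addr0 -(coxeter_symm (pr x)) wyx addr0.
  rewrite -[LHS]subr0 -wba aE bE !(wallDl, wallDr, wallZl, wallZr) wyx; ring.
have det_lt0 : c1 * d2 < c2 * d1.
  rewrite ltNge; apply/negP => det_ge0; move: dab; rewrite dabE ltNge.
  by rewrite mulr_ge0_le0 // subr_ge0.
have [c2_gt0 d1_gt0] : 0 < c2 /\ 0 < d1.
  have cd0 : 0 <= c1 * d2 by rewrite mulr_ge0.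
  split; rewrite lt_neqAle eq_sym.
    by rewrite c20 andbT; apply: contraTneq det_lt0 => ->; rewrite mul0r -leNgt.
  by rewrite d10 andbT; apply: contraTneq det_lt0 => ->; rewrite mulr0 -leNgt.
have [d2_0|d2_neq0] := eqVneq d2 0.
  have bx : pr b = d1 *: pr x by rewrite bE d2_0 scale0r addr0.
  have [E|E] : d1 *: pr x = pr x \/ d1 *: pr x = - pr x.
      by apply: (root_proportional root_neq0 root_inj); rewrite -?bx; apply: pr_root.
    by move/eqP: xb; apply; apply: pr_inj => //; rewrite bx.
  have := pr_pos Tb; rewrite bx E dotvNr oppr_gt0 => h.
  by have := lt_trans h (pr_pos Tx); rewrite ltxx.
have d2_gt0 : 0 < d2 by rewrite lt_neqAle eq_sym d2_neq0.
(* The coefficients come from eliminating [pr y] between the expansions of [pr a] and [pr b]. Hence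
   [b] lies between [a] and [x] in the ordering, and [lt a b] would put it before [x], the first
   reflection of the plane. *)
have betw : exists k1 k2 : R, [/\ 0 < k1, 0 < k2 & pr b = k1 *: pr a + k2 *: pr x].
  exists (d2 / c2), ((c2 * d1 - c1 * d2) / c2).
  rewrite !divr_gt0 ?subr_gt0 //; split=> //.
  rewrite aE bE scalerDr !scalerA addrAC -scalerDl; congr (_ *: _ + _ *: _).
    by field; rewrite gt_eqF.
  by field; rewrite gt_eqF.
have [_ conv] := hlt.
have := conv (pr b) (pr a) (pr x) (prP Tb).1 (prP Ta).1 (prP Tx).1.
rewrite !(inj_in_eq pr_inj) // eq_sym ab xb xa => /(_ isT isT isT betw) /=.
rewrite !root_refl_pr //; case=> [[_ bx]|[_ ba]]; last exact (lt_asym hlt Ta Tb ltab ba).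
case/orP: (x_first b Tb b_in) => [/eqP xb'|]; first by rewrite xb' eqxx in xb.
exact (lt_asym hlt Tb Tx bx).
Qed.

(** Any two letters of a rising word, adjacent or not, form a rising pair with product below [g], so
    all the roots are pairwise obtuse and hence simple in their span. That span contains the root of
    [t'] by [NC_span]. *)
Lemma NC_first_min (w t : W) (ts : seq W) (t' : W) :
  w \in NC T g -> reduced T w (t :: ts) -> sorted lt (t :: ts) -> t' \in T ->
  abs_length T w = (abs_length T (t' * w)%g).+1 -> (t == t') || lt t t'.
Proof.
have [[irr tr _] _] := hlt => NCw red srt Tt' len_t'.
have [ts' red'] := reduced_exists reflections_gen (t' * w)%g.
have redt' : reduced T w (t' :: ts') by rewrite redE Tt' -len_t' eqxx.
(* [pair_NC] is applied to a reduced word of [g], so that of [w] is extended first. *)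
have [us redg] := reduced_NC_cat reflections_gen NCw red.
have /and3P[Tts _ _] := red; have [freeB _] := NC_reduced NCw red.
apply: (first_simple_reflection hlt Tts srt freeB) => //; last first.
  exact: NC_span NCw red redt'.
apply: NC_obtuse_simple NCw red _.
have obtuse (p q s : seq W) (a b : W) : t :: ts = p ++ a :: q ++ b :: s ->
    dotv (pr a) (pr b) <= 0.
  move=> E; move: redg srt Tts; rewrite E -catA /= -catA /= => redg srt Tts.
  have [NCab redab] := pair_NC reflections_gen reflections_conj reflections1 redg.
  apply: rising_pair_obtuse NCab redab _.
  move: Tts; rewrite all_cat => /andP[_ /= Taqs].
  have := order_path_min_in tr Taqs (_ : path lt a (q ++ b :: s)).
  rewrite all_cat /= => h; suff /h/and3P[] : path lt a (q ++ b :: s) by [].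
  by move: srt; case: (p) => //= c C; rewrite cat_path => /andP[_ /andP[]].
move=> _ _ /mapP[a ats ->] /mapP[b bts ->] ab.
have {}ab : a != b by apply: contraNneq ab => ->.
case/splitPr E: {1}(t :: ts) / ats => [p q].
move: bts; rewrite E mem_cat inE eq_sym (negPf ab) /= => /orP[bp|bq].
  case/splitPr: bp E => [p1 p2] E; rewrite dotvC; apply: (obtuse p1 p2 q).
  by rewrite E -catA.
by case/splitPr: bq E => [q1 q2] E; apply: (obtuse p q1 q2).
Qed.

End CoxeterElement.

End ReflectionGroup.

(** * Smallest chains and EL-labeling for a Coxeter element *)

Theorem theorem3p5 (R : realType) (l : nat) (W : finGroupType)
    (rW : mx_representation R [set: W] l)
    (Phi PhiP : set 'cV[R]_l) (g : W)
    (hW : reflection_group rW)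
    (hPhi : root_system rW Phi)
    (hrank : spanning Phi)
    (hPhiP : positive_system Phi PhiP)
    (hg : coxeter_element rW Phi g) :
  let T := reflections rW in
  (forall lt : rel W, strict_total_order_on T lt ->
     forall u v : W, u \in NC T g -> v \in NC T g ->
       abs_le T u v -> u != v ->
     exists2 c : seq W,
       unique (lex_smallest (abs_le T) (NC T g) lt (@natural_label W) u v) c
       & rising lt (@natural_label W) u c)
  /\
  (forall lt : rel W, reflection_ordering rW PhiP lt ->
     compatible rW Phi PhiP g lt ->
     crystallographic Phi ->
     EL_labeling (abs_le T) (NC T g) T lt (@natural_label W)).
Proof.
move=> T; have genT := reflections_gen hW; have conjT := reflections_conj hW.
have involT := reflections_invol hW; have T1 := reflections1 rW.
split=> [lt lt_total u v _ NCv le_uv _|lt hlt hcomp cryst].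
  exact: (lex_smallest_chain genT conjT involT T1 lt_total NCv le_uv).
have [r r_neq0 PhiPE] := hPhiP; have [D hD gE] := hg.
have [pr prP] := positive_root_exists hPhi r_neq0 PhiPE.
(* Every root is, up to sign, a combination of [D], and the roots span the space. *)
have fullD : <<D>>%VS = fullv.
  have [X XPhi fullX] := hrank; have [PD _ combD] := hD.
  apply/eqP; rewrite eqEsubv subvf -fullX; apply/span_subvP => a /XPhi Pa.
  have [/nneg_comb_span//|/nneg_comb_span] := combD a Pa.
  by rewrite memvN.
apply: (EL_labeling_NC genT conjT involT T1 (proj1 hlt)) => w t ts t'.
exact: (NC_first_min hW hPhi r_neq0 PhiPE prP hD fullD gE hlt hcomp cryst).
Qed.
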